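(* Let $\mathcal L$ be an $n$-th order ordinary differential operator on $[0,L]$ with separated or periodic boundary conditions, and let $E(\lambda)$ and $W(\lambda)$ be the Evans function and the weight defined in the context. Then $\lambda\in\mathbb C$ lies in $\sigma(\mathcal L)$ if and only if $E(\lambda)=0$. Moreover, for every $\lambda^*\in\rho(\mathcal L)$ the open disk $$\left\{\lambda\in\mathbb C : |\lambda-\lambda^*|<\frac{|E(\lambda^* )|}{W(\lambda^* )}\right\}$$ is contained in $\rho(\mathcal L)$; equivalently, $|E(\lambda^* )|/W(\lambda^* )$ is a lower bound for the distance from $\lambda^*$ to $\sigma(\mathcal L)$.
   Context: Setting. Let $L>0$, $n\ge 1$, $\epsilon\in\{1,-1\}$, and let $A_0:[0,L]\to M_{n\times n}(\mathbb C)$ be smooth. Let $e_1,\dots,e_n$ be the standard basis column vectors. The operator $\mathcal L$ on $L_2(0,L)$ is the differential operator given by: $y\in \mathrm{dom}(\mathcal L)$ and $\mathcal L y=g$ ($g\in L_2(0,L)$) if and only if there is an absolutely continuous $u:[0,L]\to\mathbb C^n$ with $u_1=y$, $u'=A_0(x)u+\epsilon\, g\,e_n$, and $u$ satisfies the boundary conditions. It is assumed that $u$ is uniquely determined by $y=u_1$ (as for $u=(y,y',\dots,y^{(n-1)})$ or quasi-derivatives), so $\mathcal L$ is well defined. Thus $(\mathcal L-\lambda)y=f$ is equivalent to $u'=A(x,\lambda)u+\epsilon f e_n$ with $A(x,\lambda)=A_0(x)+\epsilon\lambda\, e_ne_1^T$. It is assumed that $\mathcal L$ has compact resolvent. Boundary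 conditions: either (separated, with $n\ge2$) $B_Lu(0)=0$ and $B_Ru(L)=0$, where for some $0<k<n$ the matrices $B_L$ ($k\times n$) and $B_R$ ($(n-k)\times n$) have orthonormal rows; or (periodic) $u(0)=u(L)$. The resolvent set $\rho(\mathcal L)$ is the set of $\lambda\in\mathbb C$ for which $(\mathcal L-\lambda)^{-1}$ exists as a bounded operator on $L_2(0,L)$; $\sigma(\mathcal L)=\mathbb C\setminus\rho(\mathcal L)$. Let $U(x)=U(x;\lambda)$ be the fundamental matrix, $U'=A(x,\lambda)U$, $U(0)=I$, and $M=M(\lambda)=U(L;\lambda)$. Separated case: let $N_L$ be a fixed ($\lambda$-independent) $n\times(n-k)$ matrix whose columns form a basis of the null space of $B_L$; set $E(\lambda)=\det(B_RMN_L)$ and $P(\lambda)=N_L\,\mathrm{adj}(B_RMN_L)\,B_RM$, where $\mathrm{adj}$ denotes the adjugate. Periodic case: set $E(\lambda)=\det(M-I)$ and $P(\lambda)=\mathrm{adj}(M-I)\,M$. In both cases set $$\mathcal G(x,y,\lambda)=\begin{cases}U(x)(E(\lambda)I-P)U^{-1}(y), & y<x,\\ -U(x)PU^{-1}(y), & y>x,\end{cases}$$ $G(x,y,\lambda)=[\mathcal G(x,y,\lambda)]_{1n}$, and $W(\lambda)=\left(\int_0^L\int_0^L|G(x,y,\lambda)|^2\,dy\,dx\right)^{1/2}$. *)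

(* Defs.v *)
From HB Require Import structures.
From mathcomp Require Import all_boot all_order all_algebra.
From mathcomp Require Import complex.
From mathcomp Require Import all_classical all_reals all_analysis.

Set Implicit Arguments.
Unset Strict Implicit.
Unset Printing Implicit Defensive.

Import Order.TTheory GRing.Theory Num.Theory.
Import numFieldNormedType.Exports.

Local Open Scope classical_set_scope.
Local Open Scope ring_scope.

(* R-valued modulus on R[i] (the generic norm `|z| takes its values in R[i]). *)
Notation cabs := ComplexField.Normc.normc.

Section Calculus.
Context {R : realType}.
Variable L : R.
Implicit Types (f g : R -> R[i]).

(* Derivative relative to [0, L], hence one-sided at 0 and at L. *)
Definition is_deriv_on (f : R -> R) (x l : R) : Prop :=
  (fun y => (f y - f x) / (y - x)) @ within `[0, L] x^' --> l.

Definition is_cderiv_on f (x : R) (l : R[i]) : Prop :=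
  is_deriv_on (fun y => complex.Re (f y)) x (complex.Re l) /\
  is_deriv_on (fun y => complex.Im (f y)) x (complex.Im l).

Definition is_mxderiv_on p q (F : R -> 'M[R[i]]_(p, q)) (x : R)
    (D : 'M[R[i]]_(p, q)) : Prop :=
  forall i j, is_cderiv_on (fun y => F y i j) x (D i j).

(* C^oo on the closed interval [0, L]; D k is the k-th derivative. *)
Definition mxsmooth_on p q (F : R -> 'M[R[i]]_(p, q)) : Prop :=
  exists D : nat -> R -> 'M[R[i]]_(p, q),
    {in `[0, L], D 0%N =1 F} /\
    forall k, {in `[0, L], forall x, is_mxderiv_on (D k) x (D k.+1 x)}.

Definition abs_continuous f : Prop :=
  forall e : R, 0 < e -> exists2 d : R, 0 < d &
    forall (N : nat) (a b : 'I_N -> R),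
      (forall i, [/\ 0 <= a i, a i <= b i & b i <= L]) ->
      trivIset setT (fun i => [set` `]a i, b i[]) ->
      \sum_(i < N) (b i - a i) < d ->
      \sum_(i < N) cabs (f (b i) - f (a i)) < e.

Definition mxabs_continuous p q (F : R -> 'M[R[i]]_(p, q)) : Prop :=
  forall i j, abs_continuous (fun x => F x i j).

Definition ae_on (P : R -> Prop) : Prop :=
  {ae @lebesgue_measure R, forall x, x \in `]0, L[ -> P x}.

(* Elements of L_2(0, L) are represented by functions on R, of which only the
   values on ]0, L[ matter, up to [ae_eqf]. *)
Definition ae_eqf f g : Prop := ae_on (fun x => f x = g x).

Definition sqnorm f : \bar R :=
  (\int[@lebesgue_measure R]_(x in `]0%R, L[) ((cabs (f x)) ^+ 2)%:E)%E.

Definition is_L2 f : Prop :=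
  [/\ measurable_fun `]0, L[ (fun x => complex.Re (f x)),
      measurable_fun `]0, L[ (fun x => complex.Im (f x)) &
      (sqnorm f < +oo)%E].

Definition L2norm f : R := Num.sqrt (fine (sqnorm f)).

Definition bounded_operator (T : (R -> R[i]) -> (R -> R[i])) : Prop :=
  [/\ forall f, is_L2 f -> is_L2 (T f),
      forall f g, is_L2 f -> is_L2 g -> ae_eqf f g -> ae_eqf (T f) (T g),
      forall (a : R[i]) f g, is_L2 f -> is_L2 g ->
        ae_eqf (T (fun x => a * f x + g x)) (fun x => a * T f x + T g x) &
      exists K : R, forall f, is_L2 f -> L2norm (T f) <= K * L2norm f].

Definition compact_operator (T : (R -> R[i]) -> (R -> R[i])) : Prop :=
  forall f_ : nat -> R -> R[i],
    (forall k, is_L2 (f_ k)) ->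
    (exists K : R, forall k, L2norm (f_ k) <= K) ->
    exists (phi : nat -> nat) (h : R -> R[i]),
      [/\ {homo phi : i j / (i < j)%N},
          is_L2 h &
          (fun k => L2norm (fun x => T (f_ (phi k)) x - h x)) @ \oo --> (0 : R)].

End Calculus.

Section Boundary.
Context {R : realType}.
Local Notation C := R[i].

(* NL only serves to define the Evans function and the Green kernel. *)
Inductive boundary_data (n : nat) : Type :=
| Separated (k : nat) (BL : 'M[C]_(k, n)) (BR : 'M[C]_(n - k, n))
    (NL : 'M[C]_(n, n - k))
| Periodic.
Arguments Periodic {n}.

(* The columns of N form a basis of { v | B v = 0 }; MathComp's kernels and
   row spaces act on row vectors, whence the transpositions. *)
Definition null_basis k n p (B : 'M[C]_(k, n)) (N : 'M[C]_(n, p)) : Prop :=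
  row_free N^T /\ (N^T :=: kermx B^T)%MS.

(* For a rectangular matrix, [unitarymx] means that the rows are orthonormal. *)
Definition boundary_ok n (bc : boundary_data n) : Prop :=
  match bc with
  | @Separated _ k BL BR NL =>
      [/\ (0 < k < n)%N, BL \is unitarymx, BR \is unitarymx & null_basis BL NL]
  | Periodic => True
  end.

Definition boundary_cond n (bc : boundary_data n) (u0 uL : 'cV[C]_n) : Prop :=
  match bc with
  | @Separated _ k BL BR NL => BL *m u0 = 0 /\ BR *m uL = 0
  | Periodic => u0 = uL
  end.

Definition evans_of n (bc : boundary_data n) (M : 'M[C]_n) : C :=
  match bc with
  | @Separated _ k BL BR NL => \det (BR *m M *m NL)
  | Periodic => \det (M - 1%:M)
  end.

Definition P_of n (bc : boundary_data n) (M : 'M[C]_n) : 'M[C]_n :=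
  match bc with
  | @Separated _ k BL BR NL => NL *m \adj (BR *m M *m NL) *m (BR *m M)
  | Periodic => \adj (M - 1%:M) *m M
  end.

End Boundary.

Section Operator.
Context {R : realType}.
Local Notation C := R[i].
Variables (L : R) (n : nat).
(* The order of the operator is n.+1. *)
Variables (eps : C) (A0 : R -> 'M[C]_n.+1) (bc : @boundary_data R n.+1).

Local Notation e1 := (delta_mx ord0 0 : 'cV[C]_n.+1).
Local Notation en := (delta_mx ord_max 0 : 'cV[C]_n.+1).

(* u witnesses that y is in the domain and that the operator maps y to g. *)
Definition op_witness (y g : R -> C) (u : R -> 'cV[C]_n.+1) : Prop :=
  [/\ is_L2 L y /\ is_L2 L g,
      mxabs_continuous L u,
      ae_eqf L (fun x => u x ord0 0) y,
      ae_on L (fun x => is_mxderiv_on L u x (A0 x *m u x + (eps * g x) *: en)) &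
      boundary_cond bc (u 0) (u L)].

Definition op_graph (y g : R -> C) : Prop := exists u, op_witness y g u.

Definition op_well_defined : Prop :=
  forall y g h u v, op_witness y g u -> op_witness y h v ->
    {in `[0, L], u =1 v}.

Definition op_shift_graph (lam : C) (y f : R -> C) : Prop :=
  exists2 g, op_graph y g & ae_eqf L f (fun x => g x - lam * y x).

Definition is_resolvent (lam : C) (T : (R -> C) -> (R -> C)) : Prop :=
  [/\ bounded_operator L T,
      forall f, is_L2 L f -> op_shift_graph lam (T f) f &
      forall y f, is_L2 L f -> op_shift_graph lam y f -> ae_eqf L (T f) y].

Definition resolvent_set : set C := [set lam | exists T, is_resolvent lam T].

Definition spectrum : set C := ~` resolvent_set.

Definition has_compact_resolvent : Prop :=
  exists lam T, is_resolvent lam T /\ compact_operator L T.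

Definition sysmx (lam : C) (x : R) : 'M[C]_n.+1 :=
  A0 x + (eps * lam) *: (en *m e1^T).

Definition is_fundamental (lam : C) (U : R -> 'M[C]_n.+1) : Prop :=
  U 0 = 1%:M /\
  {in `[0, L], forall x, is_mxderiv_on L U x (sysmx lam x *m U x)}.

(* Below, U lam x stands for U(x; lam). *)
Variable U : C -> R -> 'M[C]_n.+1.

Definition evans (lam : C) : C := evans_of bc (U lam L).

(* The value on the diagonal x = y, a null set, is irrelevant. *)
Definition green_mx (x y : R) (lam : C) : 'M[C]_n.+1 :=
  let P := P_of bc (U lam L) in
  if y < x then U lam x *m ((evans lam)%:M - P) *m invmx (U lam y)
  else - (U lam x *m P *m invmx (U lam y)).

Definition green (x y : R) (lam : C) : C := green_mx x y lam ord0 ord_max.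

Definition weight (lam : C) : R :=
  Num.sqrt (fine
    (\int[@lebesgue_measure R]_(x in `]0%R, L[)
      \int[@lebesgue_measure R]_(y in `]0%R, L[)
        ((cabs (green x y lam)) ^+ 2)%:E)%E).

End Operator.

(* Equal to +oo when S is empty. *)
Definition cdist {R : realType} (z : R[i]) (S : set R[i]) : \bar R :=
  ereal_inf [set (cabs (w - z))%:E | w in S].

(* Main.v *)
Require Import Defs.
From HB Require Import structures.
From mathcomp Require Import all_boot all_order all_algebra.
From mathcomp Require Import complex.
From mathcomp Require Import all_classical all_reals all_analysis.
From mathcomp Require Import measurable_realfun.
From mathcomp Require Import lra ring.
Import Order.TTheory GRing.Theory Num.Theory.
Import numFieldNormedType.Exports.
Local Open Scope classical_set_scope.
Local Open Scope ring_scope.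

(** Write [E] and [W] for the Evans function and the weight, [U] for the
    fundamental matrix with spectral parameter [lam], [M = U(L)] and [P] for the
    matrix in the Green kernel.

    If [E = 0], some [c <> 0] makes [u = U c] satisfy the boundary conditions,
    so [y = u_1] solves [Op y = lam y], where [Op] is the operator.  If [y]
    vanished almost everywhere, both [u] and [0] would be witnesses for the same
    [y], and well-definedness would force [u = 0], hence [c = u(0) = 0].  So
    [lam] is an eigenvalue ([evans_eigen]), and a resolvent, which determines
    the solutions of [(Op - lam) y = f] up to null sets, cannot exist there
    ([evans_neq0]).

    If [E <> 0], variation of constants gives the resolvent explicitly: with
    [F(x)] the integral over [(0, x)] of [f U^-1 e_n], the vector
    [u(x) = eps U(x) (F(x) - E^-1 P F(L))] is absolutely continuous, solves the
    equation almost everywhere and satisfies the boundary conditions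
    ([green_op_graph]).  Solutions are unique because an absolutely continuous
    solution [w] of the homogeneous equation is [U(x) w(0)], by a Gronwall
    estimate ([gronwall]), and [E <> 0] then leaves only [w(0) = 0] under the
    boundary conditions ([bvp_unique]).  Gronwall for absolutely continuous functions
    rests on [real_AC_le]: an absolutely continuous function whose derivative is
    nonpositive almost everywhere is nonincreasing.  The first component of
    [u(x)] is [(eps / E)] times the integral of the Green kernel against [f], so
    by Cauchy-Schwarz the resolvent has norm at most [W / |E|]
    ([hilbert_schmidt], [green_op_bound]).  Thus the resolvent set is exactly
    the set where [E <> 0].

    For the disk, let [lams] be in the resolvent set and suppose [E(lam) = 0]
    with eigenfunction [y].  Then [(Op - lams) y = (lam - lams) y], that is,
    [y] is the image of [(lam - lams) y] under the resolvent at [lams], and the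
    norm bound gives [|lam - lams| W(lams) / |E(lams)| >= 1]
    ([resolvent_disk]). *)

Set Implicit Arguments.
Unset Strict Implicit.
Unset Printing Implicit Defensive.

(** * Interval induction and absolute continuity on a segment *)

Section RealAnalysis.
Context {R : realType}.
Implicit Types (f g : R -> R).

(** A relation on subintervals that is additive and holds on all
    sufficiently small intervals containing any given point holds on the whole
    segment.
    It plays the role of compactness of the segment, in the form of the
    existence of tagged partitions subordinate to a gauge. *)
Lemma interval_induction (Q : R -> R -> Prop) (a b : R) : a <= b ->
  (forall c d e, a <= c -> c <= d -> d <= e -> e <= b ->
     Q c d -> Q d e -> Q c e) ->
  (forall x, a <= x -> x <= b -> exists2 r, 0 < r &
     forall c d, a <= c -> c <= x -> x <= d -> d <= b ->
       x - r < c -> d < x + r -> Q c d) ->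
  Q a b.
Proof.
move=> ab Qtrans Qloc.
pose S := [set x | [/\ a <= x, x <= b & Q a x]].
have Saa : S a.
  split=> //; have [r r0 /(_ a a)] := Qloc a (lexx _) ab.
  by apply=> //; lra.
have ubS : ubound S b by move=> x [].
have hasS : has_sup S by split; [exists a | exists b].
(* The last point that can be reached from [a]. *)
pose s := sup S.
have as_ : a <= s by apply: ub_le_sup => //; exists b.
have sb : s <= b by apply: ge_sup => //; exists a.
have [r r0 Qs] := Qloc s as_ sb.
have [x [ax xb Qax] sx] := sup_adherent r0 hasS.
have xs : x <= s by apply: ub_le_sup => //; exists b.
have Qd d : s <= d -> d <= b -> d < s + r -> Q a d.
  move=> sd db dr; apply: (Qtrans a x d) => //; first lra.
  by apply: Qs => //.
have [sb'|bs] := ltP s b; last first.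
  by have <- : s = b by [lra]; apply: Qd => //; lra.
pose t := Num.min (s + r / 2) b.
have st : s < t by rewrite lt_min sb' andbT; lra.
have tb : t <= b by rewrite ge_min lexx orbT.
have tr : t <= s + r / 2 by rewrite ge_min lexx.
have : t <= s.
  apply: ub_le_sup; first by exists b.
  by split; [lra | | apply: Qd => //; lra].
lra.
Qed.

Variable L : R.

(** Unlike the quotient, the linearized form of the derivative makes sense
    at [y = x]. *)
Lemma is_deriv_onP f x l : is_deriv_on L f x l <->
  forall e : R, 0 < e -> exists2 d : R, 0 < d & forall y, 0 <= y <= L ->
    `|y - x| < d -> `|f y - f x - l * (y - x)| <= e * `|y - x|.
Proof.
split.
- move=> /cvgrPdist_le H e e0; have := H e e0.
  move=> /nbhs_ballP[d /= d0 Hd]; exists d => // y yL yxd.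
  have [->|yx] := eqVneq y x; first by rewrite !subrr mulr0 subr0 normr0 mulr0.
  have := Hd y; rewrite /ball /= distrC => /(_ yxd yx).
  rewrite in_itv/= => /(_ yL).
  have yx0 : y - x != 0 by rewrite subr_eq0.
  rewrite -(ler_pM2r (_ : 0 < `|y - x|)) ?normr_gt0// -normrM => h.
  apply: le_trans h; rewrite distrC mulrBl -mulrA mulVf// mulr1; exact: lexx.
- move=> H; apply/cvgrPdist_le => e e0; have [d d0 Hd] := H e e0.
  apply/nbhs_ballP; exists d => //= y; rewrite /ball/= distrC => yxd yx.
  rewrite in_itv/= => yL.
  have yx0 : y - x != 0 by rewrite subr_eq0.
  rewrite -(ler_pM2r (_ : 0 < `|y - x|)) ?normr_gt0// -normrM.
  by rewrite mulrBl -mulrA mulVf// mulr1 distrC; exact: Hd.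
Qed.

Lemma deriv_on_lipschitz f K :
  (forall x, 0 <= x <= L -> exists2 l, is_deriv_on L f x l & `|l| <= K) ->
  forall x y, 0 <= x <= L -> 0 <= y <= L -> `|f y - f x| <= K * `|y - x|.
Proof.
move=> Hf x y.
wlog xy : x y / x <= y.
  move=> W hx hy; have [/W|/ltW/W] := leP x y; first exact.
  by rewrite distrC (distrC x); apply.
move=> /andP[x0 _] /andP[_ yL].
apply/ler_addgt0Pr => e e0.
(* The slope is relaxed by [e'], which costs at most [e] in total; the [1]
   covers the case [y = x]. *)
pose e' := e / (1 + `|y - x|).
have p0 : 0 < 1 + `|y - x| by rewrite ltr_pwDl.
have e'0 : 0 < e' by rewrite divr_gt0.
apply: (@le_trans _ _ ((K + e') * (y - x))); last first.
  have := divfK (lt0r_neq0 p0) e; rewrite -/e' ger0_norm ?subr_ge0//.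
  by move: e'0; clear; lra.
apply: (@interval_induction
  (fun c d => `|f d - f c| <= (K + e') * (d - c)) x y) => //.
- move=> a b c _ _ _ _ h1 h2.
  rewrite (_ : f c - f a = (f c - f b) + (f b - f a)); last by ring.
  by apply: le_trans (ler_normD _ _) _; lra.
- move=> z xz zy.
  have [|l /is_deriv_onP dl lK] := Hf z; first by lra.
  have [d d0 Hd] := dl _ e'0; exists d => // a b xa az zb by_ da bd.
  have h1 := Hd a; have h2 := Hd b.
  have {h1} : `|f a - f z - l * (a - z)| <= e' * (z - a).
    rewrite (le_trans (h1 _ _))//; first by lra.
      by rewrite ler0_norm; lra.
    by rewrite ler0_norm; lra.
  have {h2} : `|f b - f z - l * (b - z)| <= e' * (b - z).
    rewrite (le_trans (h2 _ _))//; first by lra.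
      by rewrite ger0_norm; lra.
    by rewrite ger0_norm; lra.
  move=> h2 h1.
  have -> : f b - f a = (f b - f z - l * (b - z)) -
      (f a - f z - l * (a - z)) + l * (b - a) by ring.
  apply: le_trans (ler_normD _ _) _.
  have h3 : `|l * (b - a)| <= K * (b - a).
    by rewrite normrM (ger0_norm (_ : 0 <= b - a)) ?ler_wpM2r//; lra.
  have := ler_normB (f b - f z - l * (b - z)) (f a - f z - l * (a - z)).
  lra.
Qed.

(** Absolute continuity on [[0, L]] for real-valued functions, with the same
    quantification over finite families of disjoint intervals as
    [abs_continuous]. *)
Definition real_AC f : Prop :=
  forall e : R, 0 < e -> exists2 d : R, 0 < d &
    forall (N : nat) (a b : 'I_N -> R),
      (forall i, [/\ 0 <= a i, a i <= b i & b i <= L]) ->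
      trivIset setT (fun i => [set` `]a i, b i[]) ->
      \sum_(i < N) (b i - a i) < d ->
      \sum_(i < N) `|f (b i) - f (a i)| < e.

Lemma real_AC_cst k : real_AC (fun=> k).
Proof.
move=> e e0; exists 1 => // N a b _ _ _.
by under eq_bigr do rewrite subrr normr0; rewrite big1.
Qed.

Lemma real_AC_lip f K :
  (forall x y, 0 <= x <= L -> 0 <= y <= L -> `|f y - f x| <= K * `|y - x|) ->
  real_AC f.
Proof.
move=> Hf e e0; pose K' := `|K| + 1.
have K'0 : 0 < K' by rewrite /K' ltr_wpDl.
exists (e / K'); first by rewrite divr_gt0.
move=> N a b Hab _ sumd.
apply: (@le_lt_trans _ _ (\sum_(i < N) K' * (b i - a i))).
  apply: ler_sum => i _; have [a0 aibi biL] := Hab i.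
  apply: le_trans (Hf _ _ _ _) _; [lra|lra|].
  rewrite ger0_norm; last by lra.
  apply: ler_wpM2r; first by lra.
  by rewrite /K'; have := ler_norm K; lra.
by rewrite -mulr_sumr mulrC -ltr_pdivlMr.
Qed.

Lemma real_ACD f g : real_AC f -> real_AC g -> real_AC (fun x => f x + g x).
Proof.
move=> Hf Hg e e0; have e20 : 0 < e / 2 by lra.
have [d1 d10 H1] := Hf _ e20; have [d2 d20 H2] := Hg _ e20.
exists (Num.min d1 d2); first by rewrite lt_min d10.
move=> N a b Hab tI; rewrite lt_min => /andP[s1 s2].
have := H1 _ _ _ Hab tI s1; have := H2 _ _ _ Hab tI s2.
move=> h2 h1.
apply: (@le_lt_trans _ _ (\sum_(i < N) (`|f (b i) - f (a i)|
  + `|g (b i) - g (a i)|))).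
  apply: ler_sum => i _.
  have -> : f (b i) + g (b i) - (f (a i) + g (a i)) =
    (f (b i) - f (a i)) + (g (b i) - g (a i)) by ring.
  exact: ler_normD.
by rewrite big_split/=; lra.
Qed.

Lemma real_AC_loc f e : real_AC f -> 0 < e -> exists2 d, 0 < d &
  forall x y, 0 <= x <= L -> 0 <= y <= L -> `|y - x| < d -> `|f y - f x| < e.
Proof.
move=> Hf e0; have [d d0 Hd] := Hf _ e0; exists d => // x y.
wlog xy : x y / x <= y.
  move=> W hx hy; have [/W|/ltW/W] := leP x y; first exact.
  by rewrite (distrC y) (distrC (f y)); apply.
move=> xL yL; rewrite ger0_norm ?subr_ge0// => xyd.
have := Hd 1%N (fun=> x) (fun=> y); rewrite !big_ord1; apply => //.
- by move=> _; split; lra.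
- by move=> i j _ _ _; rewrite (ord1 i) (ord1 j).
Qed.

Lemma real_AC_bounded f : 0 <= L -> real_AC f ->
  exists K, forall x, 0 <= x <= L -> `|f x| <= K.
Proof.
move=> L0 Hf; have [d d0 Hd] := real_AC_loc Hf ltr01.
apply: (@interval_induction
  (fun a b => exists K, forall x, a <= x <= b -> `|f x| <= K) 0 L) => //.
- move=> a b c _ _ _ _ [K1 H1] [K2 H2]; exists (Num.max K1 K2) => x xac.
  rewrite le_max; have [xb|bx] := leP x b; first by rewrite H1//; lra.
  by rewrite H2 ?orbT//; lra.
- move=> x x0 xL; exists d => // a b a0 ax xb bL da bd.
  exists (`|f x| + 1) => y yab.
  have := Hd x y; rewrite x0 xL => /(_ isT).
  have -> : 0 <= y <= L by lra.
  move=> /(_ isT); have -> : `|y - x| < d by rewrite lter_norml; lra.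
  move=> /(_ isT) h.
  rewrite -lerBlDl; apply: le_trans (lerB_dist _ _) _; exact: ltW.
Qed.

Lemma real_ACM f g : 0 <= L -> real_AC f -> real_AC g ->
  real_AC (fun x => f x * g x).
Proof.
move=> L0 Hf Hg e e0.
have [Kf HKf] := real_AC_bounded L0 Hf; have [Kg HKg] := real_AC_bounded L0 Hg.
pose K := `|Kf| + `|Kg| + 1.
have K0 : 0 < K by rewrite /K ltr_wpDl// addr_ge0.
have e20 : 0 < e / 2 / K by rewrite !divr_gt0.
have [d1 d10 H1] := Hf _ e20; have [d2 d20 H2] := Hg _ e20.
exists (Num.min d1 d2); first by rewrite lt_min d10.
move=> N a b Hab tI; rewrite lt_min => /andP[s1 s2].
have := H1 _ _ _ Hab tI s1; have := H2 _ _ _ Hab tI s2.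
move=> h2 h1.
apply: (@le_lt_trans _ _ (\sum_(i < N)
    (K * `|f (b i) - f (a i)| + K * `|g (b i) - g (a i)|))).
  apply: ler_sum => i _; have [a0 aibi biL] := Hab i.
  have -> : f (b i) * g (b i) - (f (a i) * g (a i)) =
    g (b i) * (f (b i) - f (a i)) + f (a i) * (g (b i) - g (a i)) by ring.
  apply: le_trans (ler_normD _ _) _; rewrite !normrM.
  have := ler_norm Kf; have := ler_norm Kg.
  have := normr_ge0 Kf; have := normr_ge0 Kg => p1 p2 p3 p4.
  apply: lerD; apply: ler_wpM2r => //.
    by apply: le_trans (HKg _ _) _; rewrite /K; lra.
  by apply: le_trans (HKf _ _) _; rewrite /K; lra.
rewrite big_split/= -!mulr_sumr.
move: h1 h2; rewrite !ltr_pdivlMr// => h1 h2; lra.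
Qed.
End RealAnalysis.

(** * Monotonicity of absolutely continuous functions *)

Section AE.
Context {R : realType}.
Variable L : R.

Lemma ae_onW (P : R -> Prop) : (forall x, 0 < x < L -> P x) -> ae_on L P.
Proof. by move=> H; apply: aeW => x; rewrite in_itv/=; exact: H. Qed.

Lemma ae_onS (P Q : R -> Prop) : (forall x, 0 < x < L -> P x -> Q x) ->
  ae_on L P -> ae_on L Q.
Proof.
have FF := ae_filter_ringOfSetsType (@lebesgue_measure R).
rewrite /ae_on => PQ; apply: filterS => x H xI; apply: PQ; last exact: H.
by move: xI; rewrite in_itv.
Qed.

Lemma ae_on2 (P Q S : R -> Prop) : (forall x, 0 < x < L -> P x -> Q x -> S x) ->
  ae_on L P -> ae_on L Q -> ae_on L S.
Proof.
have FF := ae_filter_ringOfSetsType (@lebesgue_measure R).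
rewrite /ae_on => PQ; apply: filterS2 => x H1 H2 xI; apply: PQ;
  [|exact: H1|exact: H2].
by move: xI; rewrite in_itv.
Qed.

Lemma ae_on_forall (I : finType) (P : I -> R -> Prop) :
  (forall i, ae_on L (P i)) -> ae_on L (fun x => forall i, P i x).
Proof.
have FF := ae_filter_ringOfSetsType (@lebesgue_measure R).
rewrite /ae_on => H; have := filter_forall FF H.
by apply: filterS => x Hx xI i; exact: Hx.
Qed.
End AE.

Section RealAC.
Context {R : realType}.
Implicit Types (f g : R -> R).
Variable L : R.
Local Notation mu := (@lebesgue_measure R).

(** A property that holds almost everywhere on [(0, L)] holds outside an open
    set of small measure; the endpoints are thrown into the open set. *)
Lemma ae_on_cover (P : R -> Prop) (d : R) : ae_on L P -> 0 < d ->
  exists V : set R, [/\ open V, (mu V < d%:E)%E &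
    forall x, 0 <= x <= L -> ~ V x -> 0 < x < L /\ P x].
Proof.
move=> [B [mB B0 HB]] d0.
pose B' : set R := B `|` ([set 0] `|` [set L]).
have mB' : measurable B' by apply: measurableU => //; exact: measurableU.
have B'0 : mu B' = 0%E.
  apply/measure_negligible => //; apply: negligibleU;
    first by apply/negligibleP.
  by apply: negligibleU; apply/negligibleP => //; exact: lebesgue_measure_set1.
have Bfin : (mu B' < +oo)%E by rewrite B'0.
have [V [oV BO OB]] := lebesgue_regularity_outer mB' Bfin d0.
exists V; split=> //.
- rewrite -(setDKU BO); apply: (@le_lt_trans _ _ (mu (V `\` B') + mu B')%E).
    apply: measureU2 => //.
    by apply: measurableD => //; exact: measurable_realfun.open_measurable.
  by rewrite B'0 adde0.
- move=> x xL nOx.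
  have nBx : ~ B' x by move=> /BO.
  have x0 : x != 0 by apply/eqP => x0; apply: nBx; right; left.
  have xL' : x != L by apply/eqP => xeL; apply: nBx; right; right.
  have xL0 : 0 < x < L by case/andP: xL => h1 h2;
    rewrite !lt_neqAle (eq_sym 0) x0 xL' h1 h2.
  split=> //; apply: contrapT => nPx; apply: nBx; left; apply: HB => /= H.
  by apply: nPx; apply: H; rewrite in_itv.
Qed.

(** A finite list of intervals contained in [[c, d]], sorted from left to
    right with disjoint interiors. *)
Definition itv_chain (c d : R) (s : seq (R * R)) :=
  all (fun p => [&& c <= p.1, p.1 <= p.2 & p.2 <= d]) s &&
  pairwise (fun p q : R * R => p.2 <= q.1) s.

Lemma itv_chain_cat c d e s t : c <= d -> d <= e ->
  itv_chain c d s -> itv_chain d e t -> itv_chain c e (s ++ t).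
Proof.
move=> cd de /andP[/allP s1 s2] /andP[/allP t1 t2]; apply/andP; split.
  rewrite all_cat; apply/andP; split; apply/allP => p /=.
    by move=> /s1/and3P[-> -> /=] /le_trans; apply.
  by move=> /t1/and3P[h -> ->]; rewrite (le_trans cd h).
rewrite pairwise_cat s2 t2 !andbT;
  apply/allrelP => p q /s1/and3P[_ _ h] /t1/and3P[h' _ _].
exact: le_trans h h'.
Qed.

Lemma real_AC_chain f e : real_AC L f -> 0 < e -> exists2 d, 0 < d & forall s,
  itv_chain 0 L s -> \sum_(p <- s) (p.2 - p.1) < d ->
  \sum_(p <- s) `|f p.2 - f p.1| < e.
Proof.
move=> Hf e0; have [d d0 Hd] := Hf _ e0; exists d => // s /andP[/allP s1 s2] sd.
rewrite big_tnth; apply: (Hd _ (fun i => (tnth (in_tuple s) i).1) (fun i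
  => (tnth (in_tuple s) i).2)).
- by move=> i; have /s1/and3P[] := mem_tnth i (in_tuple s).
- suff H : forall i j : 'I_(size s), (i < j)%N ->
      (tnth (in_tuple s) i).2 <= (tnth (in_tuple s) j).1.
    move=> i j _ _ [x [/=]]; rewrite !in_itv/= => /andP[a1 a2] /andP[b1 b2].
    have [ij|ij|/val_inj//] := ltngtP i j.
    - by have := H _ _ ij; rewrite leNgt (lt_trans b1 a2).
    - by have := H _ _ ij; rewrite leNgt (lt_trans a1 b2).
  move=> i j ij; rewrite !(tnth_nth (0, 0)) /=.
  by move/(pairwiseP (0, 0)): s2; apply; rewrite ?inE.
- by move: sd; rewrite big_tnth.
Qed.

(** The exceptional points of the derivative are covered by an open set
    [V] of small measure.  Interval induction yields a partition of [[a, b]] into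
    intervals on which the increment of [f] is controlled by the derivative, and
    intervals contained in [V]; absolute continuity bounds the increments over
    the latter.  The list [s] in the invariant [Q] collects those, and its total
    length is bounded by the measure of the part of [V] in the interval. *)
Lemma real_AC_le f a b : real_AC L f -> 0 <= a -> a <= b -> b <= L ->
  ae_on L (fun x => exists2 l, is_deriv_on L f x l & l <= 0) -> f b <= f a.
Proof.
move=> Hf a0 ab bL Hae.
suff H e : 0 < e -> f b - f a <= e * (b - a + 1).
  rewrite -subr_le0; apply/ler_addgt0Pr => e e0; rewrite add0r.
  have p0 : 0 < b - a + 1 by lra.
  by have := H (e / (b - a + 1)) (divr_gt0 e0 p0); rewrite divfK ?gt_eqF.
move=> e0; have [d d0 Hd] := real_AC_chain Hf e0.
have [V [oV Od HO]] := ae_on_cover Hae d0.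
have mO : measurable V by exact: measurable_realfun.open_measurable.
pose Q c d := exists s, [/\ itv_chain c d s,
  ((\sum_(p <- s) (p.2 - p.1))%:E <= mu (V `&` `[c, d[%classic))%E &
  f d - f c <= e * (d - c) + \sum_(p <- s) `|f p.2 - f p.1|].
have [s [s1 s2 s3]] : Q a b.
  apply: interval_induction => //.
  - move=> c z g _ cz zg _ [s [s1 s2 s3]] [t [t1 t2 t3]].
    exists (s ++ t); split; first exact: itv_chain_cat s1 t1.
    + rewrite big_cat EFinD (@itv_bndbnd_setU _ _ (BLeft c) (BLeft z) (BLeft
      g)) ?bnd_simp//.
      rewrite setIUr measureU; first exact: leeD.
      * by apply: measurableI.
      * by apply: measurableI.
      * rewrite -setIIr; apply/seteqP; split => x //= [_ []].
        by rewrite /= !in_itv/= => /andP[_ xz] /andP[zx _]; move: xz;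
          rewrite ltNge zx.
    + by rewrite big_cat/=; lra.
  - move=> x ax xb; have xL : 0 <= x <= L by rewrite (le_trans a0 ax) (le_trans
    xb bL).
    have [Ox|nOx] := pselect (V x).
    + have /nbhs_ballP[r /= r0 Hr] : nbhs x V by exact: open_nbhs_nbhs.
      exists r => // c z ac cx xz zb rc zr; exists [:: (c, z)]; split.
      * by rewrite /itv_chain /= !lexx (le_trans cx xz).
      * rewrite big_seq1 /= setIidr; last first.
          move=> y /=; rewrite in_itv/= => /andP[cy yz]; apply: Hr.
          by rewrite /ball/= ltr_norml; apply/andP; split; clear -rc zr cy yz;
            lra.
        by rewrite lebesgue_measure_itv/= lte_fin; case: ifPn => [cz|];
          rewrite ?EFinB// -leNgt => zc; rewrite lee_fin subr_le0.
      * rewrite big_seq1 /=; apply: ler_wpDl; last exact: ler_norm.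
        by apply: mulr_ge0; [exact: ltW | rewrite subr_ge0 (le_trans cx xz)].
    + have [_ [l /is_deriv_onP Hl l0]] := HO _ xL nOx.
      have [r r0 Hr] := Hl _ e0; exists r => // c z ac cx xz zb rc zr.
      exists [::]; split; [by []|by rewrite big_nil measure_ge0|].
      rewrite big_nil addr0.
      have cL : 0 <= c <= L by apply/andP; split; clear -ac cx a0 xL; lra.
      have zL : 0 <= z <= L by apply/andP; split; clear -zb xz bL xL; lra.
      have cxr : `|c - x| < r by rewrite ltr_norml; apply/andP; split;
        clear -rc cx r0; lra.
      have zxr : `|z - x| < r by rewrite ltr_norml; apply/andP; split;
        clear -zr xz r0; lra.
      have := Hr _ cL cxr; have := Hr _ zL zxr.
      rewrite (ler0_norm (_ : c - x <= 0)) ?subr_le0//.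
      rewrite (ger0_norm (_ : 0 <= z - x)) ?subr_ge0//.
      rewrite !ler_norml => /andP[_ h1] /andP[h2 _].
      have h3 : l * (z - c) <= 0 by rewrite mulr_le0_ge0 // subr_ge0 (le_trans
        cx xz).
      by clear -h1 h2 h3; lra.
have sab : itv_chain 0 L s.
  case/andP: s1 => /allP s1 s1'; rewrite /itv_chain s1' andbT.
  apply/allP => p /s1/and3P[h1 -> h2] /=.
  by rewrite (le_trans a0 h1) (le_trans h2 bL).
have {}s2 : \sum_(p <- s) (p.2 - p.1) < d.
  rewrite -lte_fin (le_lt_trans s2)// (le_lt_trans _ Od)// le_measure// ?inE//.
  exact: measurableI.
have := Hd _ sab s2; clear -s3; lra.
Qed.

End RealAC.

(** * Relative derivatives *)

Section RealDeriv.
Context {R : realType}.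
Implicit Types (f g : R -> R).
Variable L : R.
Lemma is_deriv_cst (k x : R) : is_deriv_on L (fun=> k) x 0.
Proof.
apply/is_deriv_onP => e e0; exists 1 => // y _ _.
by rewrite subrr mul0r subrr normr0 mulr_ge0// ltW.
Qed.

Lemma is_derivD f g x a b : is_deriv_on L f x a -> is_deriv_on L g x b ->
  is_deriv_on L (fun y => f y + g y) x (a + b).
Proof.
move=> Hf Hg; rewrite /is_deriv_on.
rewrite (_ : (fun y => _) = (fun y => (f y - f x) / (y - x) + (g y - g x) / (y
  - x))).
  exact: cvgD Hf Hg.
by apply/funext => y; ring.
Qed.

Lemma is_derivN f x a : is_deriv_on L f x a ->
  is_deriv_on L (fun y => - f y) x (- a).
Proof.
move=> Hf; rewrite /is_deriv_on.
rewrite (_ : (fun y => _) = (fun y => - ((f y - f x) / (y - x)))).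
  exact: cvgN Hf.
by apply/funext => y; ring.
Qed.

Lemma is_deriv_continuous f x a : is_deriv_on L f x a ->
  f @ within `[0, L] x^' --> f x.
Proof.
move=> /is_deriv_onP Hf; apply/cvgrPdist_le => e e0.
have [d d0 Hd] := Hf 1 ltr01.
have p0 : 0 < `|a| + 1 by rewrite ltr_wpDl.
apply/nbhs_ballP; exists (Num.min d (e / (`|a| + 1))).
  by rewrite /= lt_min d0 divr_gt0.
move=> y; rewrite /ball/= distrC lt_min => /andP[yd ye] _.
rewrite in_itv/= => yL; have := Hd _ yL yd; rewrite mul1r => h.
move: ye; rewrite ltr_pdivlMr// => ye.
rewrite distrC -[f y - f x](subrK (a * (y - x))).
apply: le_trans (ler_normD _ _) _; rewrite normrM.
move: h ye; clear; lra.
Qed.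

Lemma is_derivM f g x a b : is_deriv_on L f x a -> is_deriv_on L g x b ->
  is_deriv_on L (fun y => f y * g y) x (a * g x + f x * b).
Proof.
move=> Hf Hg; have cf := is_deriv_continuous Hf; rewrite /is_deriv_on.
rewrite (_ : (fun y => _) = (fun y => (f y - f x) / (y - x) * g x +
   f y * ((g y - g x) / (y - x)))).
  by apply: cvgD; [apply: cvgMr_tmp; exact: Hf|exact: cvgM cf Hg].
by apply/funext => y; ring.
Qed.

Lemma derivable_is_deriv_on f x : derivable f x 1 ->
  is_deriv_on L f x (derive1 f x).
Proof.
move=> df; have : (fun h => h^-1 *: (f (h *: (1:R) + x) - f x)) @ 0^' -->
  derive1 f x.
  by rewrite derive1E; exact: df.
move=> /cvgrPdist_le H; apply/is_deriv_onP => e e0.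
have /nbhs_ballP[d /= d0 Hd] := H e e0; exists d => // y yL yxd.
have [->|yx] := eqVneq y x; first by rewrite !subrr mulr0 subr0 normr0 mulr0.
have yx0 : y - x != 0 by rewrite subr_eq0.
have := Hd (y - x); rewrite /ball /= sub0r normrN => /(_ yxd yx0).
rewrite /GRing.scale /= mulr1 subrK => h.
rewrite -(ler_pM2r (_ : 0 < `|y - x|)) ?normr_gt0// -normrM in h.
by move: h; rewrite mulrBl mulrAC mulVf// mul1r distrC.
Qed.
End RealDeriv.

(** * Complex-valued and matrix-valued functions *)

Section ComplexCalculus.
Context {R : realType}.
Local Notation C := R[i].
Local Notation Re := (@complex.Re R).
Local Notation Im := (@complex.Im R).
Implicit Types (z : C) (f g : R -> C).

Lemma ReD z w : Re (z + w) = Re z + Re w. Proof. by case: z; case: w. Qed.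
Lemma ImD z w : Im (z + w) = Im z + Im w. Proof. by case: z; case: w. Qed.
Lemma ReN z : Re (- z) = - Re z. Proof. by case: z. Qed.
Lemma ImN z : Im (- z) = - Im z. Proof. by case: z. Qed.
Lemma ReM z w : Re (z * w) = Re z * Re w - Im z * Im w.
Proof. by case: z; case: w. Qed.
Lemma ImM z w : Im (z * w) = Re z * Im w + Im z * Re w.
Proof. by case: z; case: w. Qed.

Lemma cabs_ge0 z : 0 <= cabs z.
Proof. by case: z => a b; exact: sqrtr_ge0. Qed.

Lemma sqr_cabs z : cabs z ^+ 2 = Re z ^+ 2 + Im z ^+ 2.
Proof. by case: z => a b /=; rewrite sqr_sqrtr// addr_ge0// sqr_ge0. Qed.

Lemma Re_le_cabs z : `|Re z| <= cabs z.
Proof.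
by case: z => a b /=; rewrite -sqrtr_sqr ler_wsqrtr// lerDl sqr_ge0.
Qed.

Lemma Im_le_cabs z : `|Im z| <= cabs z.
Proof.
by case: z => a b /=; rewrite -sqrtr_sqr ler_wsqrtr// lerDr sqr_ge0.
Qed.

Lemma cabs_le z : cabs z <= `|Re z| + `|Im z|.
Proof.
rewrite -(ler_pXn2r (_ : 0 < 2)%N) ?nnegrE ?cabs_ge0 ?addr_ge0//.
rewrite sqr_cabs sqrrD !real_normK ?num_real//.
by rewrite [leRHS]addrAC lerDl mulrn_wge0// mulr_ge0.
Qed.

Lemma cabsN z : cabs (- z) = cabs z.
Proof. by case: z => a b /=; rewrite !sqrrN. Qed.

Lemma cabsD z w : cabs (z + w) <= cabs z + cabs w.
Proof. exact: le_normcD. Qed.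

Lemma cabsM z w : cabs (z * w) = cabs z * cabs w.
Proof. exact: ComplexField.Normc.normcM. Qed.

Lemma cabs_sum I (r : seq I) (P : pred I) (F : I -> C) :
  cabs (\sum_(i <- r | P i) F i) <= \sum_(i <- r | P i) cabs (F i).
Proof.
elim/big_ind2 : _ => [|x a y b xa yb|//];
  first by rewrite ComplexField.Normc.normc0.
by apply: le_trans (cabsD _ _) (lerD xa yb).
Qed.

Variable L : R.

Lemma is_cderiv_cst (k : C) x : is_cderiv_on L (fun=> k) x 0.
Proof. by split; exact: is_deriv_cst. Qed.

Lemma is_cderivD f g x a b : is_cderiv_on L f x a -> is_cderiv_on L g x b ->
  is_cderiv_on L (fun y => f y + g y) x (a + b).
Proof.
move=> [fr fi] [gr gi]; split.
  under eq_fun do rewrite ReD; rewrite ReD; exact: is_derivD.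
under eq_fun do rewrite ImD; rewrite ImD; exact: is_derivD.
Qed.

Lemma is_cderivM f g x a b : is_cderiv_on L f x a -> is_cderiv_on L g x b ->
  is_cderiv_on L (fun y => f y * g y) x (a * g x + f x * b).
Proof.
move=> [fr fi] [gr gi]; split.
  under eq_fun do rewrite ReM.
  rewrite (_ : Re _ = (Re a * Re (g x) + Re (f x) * Re b) +
     - (Im a * Im (g x) + Im (f x) * Im b)); last by rewrite ReD !ReM; ring.
  by apply: is_derivD; [exact: is_derivM|apply: is_derivN; exact: is_derivM].
under eq_fun do rewrite ImM.
rewrite (_ : Im _ = (Re a * Im (g x) + Re (f x) * Im b) +
   (Im a * Re (g x) + Im (f x) * Re b)); last by rewrite ImD !ImM; ring.
by apply: is_derivD; exact: is_derivM.
Qed.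

Lemma is_cderiv_sum I (r : seq I) (F : I -> R -> C) x (D : I -> C) :
  (forall i, is_cderiv_on L (F i) x (D i)) ->
  is_cderiv_on L (fun y => \sum_(i <- r) F i y) x (\sum_(i <- r) D i).
Proof.
move=> H; elim: r => [|i r IHr].
  by rewrite big_nil; under eq_fun do rewrite big_nil; exact: is_cderiv_cst.
by rewrite big_cons; under eq_fun do rewrite big_cons; exact: is_cderivD.
Qed.

Lemma is_mxderiv_cst p q (A : 'M[C]_(p, q)) x : is_mxderiv_on L (fun=> A) x 0.
Proof. by move=> i j; rewrite mxE; exact: is_cderiv_cst. Qed.

Lemma is_mxderivD p q (F G : R -> 'M[C]_(p, q)) x A B :
  is_mxderiv_on L F x A -> is_mxderiv_on L G x B ->
  is_mxderiv_on L (fun y => F y + G y) x (A + B).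
Proof.
move=> HF HG i j; rewrite mxE; under eq_fun do rewrite mxE.
exact: is_cderivD.
Qed.

Lemma is_mxderivM p q r (F : R -> 'M[C]_(p, q)) (G : R -> 'M[C]_(q, r)) x A B :
  is_mxderiv_on L F x A -> is_mxderiv_on L G x B ->
  is_mxderiv_on L (fun y => F y *m G y) x (A *m G x + F x *m B).
Proof.
move=> HF HG i j; rewrite !mxE -big_split/=; under eq_fun do rewrite mxE.
by apply: is_cderiv_sum => k; exact: is_cderivM.
Qed.

Lemma is_mxderivMl p q r (A : 'M[C]_(p, q)) (G : R -> 'M[C]_(q, r)) x B :
  is_mxderiv_on L G x B -> is_mxderiv_on L (fun y => A *m G y) x (A *m B).
Proof.
by move=> HG; have := is_mxderivM (is_mxderiv_cst A x) HG; rewrite mul0mx add0r.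
Qed.

Lemma is_mxderivMr p q r (F : R -> 'M[C]_(p, q)) (B : 'M[C]_(q, r)) x A :
  is_mxderiv_on L F x A -> is_mxderiv_on L (fun y => F y *m B) x (A *m B).
Proof.
by move=> HF; have := is_mxderivM HF (is_mxderiv_cst B x); rewrite mulmx0 addr0.
Qed.

Lemma abs_continuousP f : abs_continuous L f <->
  real_AC L (fun x => Re (f x)) /\ real_AC L (fun x => Im (f x)).
Proof.
split=> [Hf|[Hr Hi]].
  split=> e e0; have [d d0 Hd] := Hf _ e0; exists d => // N a b h1 h2 h3;
    apply: le_lt_trans (Hd _ _ _ h1 h2 h3); apply: ler_sum => i _.
    by rewrite -ReN -ReD; exact: Re_le_cabs.
  by rewrite -ImN -ImD; exact: Im_le_cabs.
move=> e e0; have e20 : 0 < e / 2 by rewrite divr_gt0.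
have [d1 d10 H1] := Hr _ e20; have [d2 d20 H2] := Hi _ e20.
exists (Num.min d1 d2); first by rewrite lt_min d10.
move=> N a b Hab tI; rewrite lt_min => /andP[s1 s2].
have h1 := H1 _ _ _ Hab tI s1; have h2 := H2 _ _ _ Hab tI s2.
rewrite (splitr e); apply: le_lt_trans (ltrD h1 h2).
rewrite -big_split/=; apply: ler_sum => i _.
by apply: le_trans (cabs_le _) _; rewrite ReD ReN ImD ImN.
Qed.

Lemma abs_continuous_cst (k : C) : abs_continuous L (fun=> k).
Proof. by apply/abs_continuousP; split; exact: real_AC_cst. Qed.

Lemma abs_continuousD f g : abs_continuous L f -> abs_continuous L g ->
  abs_continuous L (fun x => f x + g x).
Proof.
move=> /abs_continuousP[fr fi] /abs_continuousP[gr gi].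
apply/abs_continuousP; split.
  rewrite (_ : (fun _ => _) = fun x => Re (f x) + Re (g x)).
    exact: real_ACD fr gr.
  by apply/funext => x; rewrite ReD.
rewrite (_ : (fun _ => _) = fun x => Im (f x) + Im (g x)).
  exact: real_ACD fi gi.
by apply/funext => x; rewrite ImD.
Qed.

Lemma abs_continuousM f g : 0 <= L -> abs_continuous L f ->
  abs_continuous L g -> abs_continuous L (fun x => f x * g x).
Proof.
move=> L0 /abs_continuousP[fr fi] /abs_continuousP[gr gi].
apply/abs_continuousP; split.
  rewrite (_ : (fun _ => _) = fun x => Re (f x) * Re (g x) +
      (-1) * (Im (f x) * Im (g x))).
    by apply: real_ACD; do ?apply: real_ACM => //; exact: real_AC_cst.
  by apply/funext => x; rewrite ReM mulN1r.
rewrite (_ : (fun _ => _) = fun x => Re (f x) * Im (g x) +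
    Im (f x) * Re (g x)).
  by apply: real_ACD; exact: real_ACM.
by apply/funext => x; rewrite ImM.
Qed.

Lemma abs_continuous_sum I (r : seq I) (F : I -> R -> C) :
  (forall i, abs_continuous L (F i)) ->
  abs_continuous L (fun y => \sum_(i <- r) F i y).
Proof.
move=> H; elim: r => [|i r IHr].
  by under eq_fun do rewrite big_nil; exact: abs_continuous_cst.
by under eq_fun do rewrite big_cons; exact: (abs_continuousD (H i) IHr).
Qed.

Lemma mxAC_cst p q (A : 'M[C]_(p, q)) : mxabs_continuous L (fun=> A).
Proof. by move=> i j; exact: abs_continuous_cst. Qed.

Lemma mxACD p q (F G : R -> 'M[C]_(p, q)) : mxabs_continuous L F ->
  mxabs_continuous L G -> mxabs_continuous L (fun y => F y + G y).
Proof.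
move=> HF HG i j; under eq_fun do rewrite mxE.
exact: (abs_continuousD (HF i j) (HG i j)).
Qed.

Lemma mxACM p q r (F : R -> 'M[C]_(p, q)) (G : R -> 'M[C]_(q, r)) : 0 <= L ->
  mxabs_continuous L F -> mxabs_continuous L G ->
  mxabs_continuous L (fun y => F y *m G y).
Proof.
move=> L0 HF HG i j; under eq_fun do rewrite mxE.
by apply: (@abs_continuous_sum _ _ (fun k y => F y i k * G y k j)) => k;
  exact: (abs_continuousM L0 (HF i k) (HG k j)).
Qed.

Lemma abs_continuous_bounded f : 0 <= L -> abs_continuous L f ->
  exists K, forall x, 0 <= x <= L -> cabs (f x) <= K.
Proof.
move=> L0 /abs_continuousP[/(real_AC_bounded L0)[K1 H1] /(real_AC_bounded
  L0)[K2 H2]].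
exists (K1 + K2) => x xL; apply: le_trans (cabs_le _) _.
by apply: lerD; [exact: H1|exact: H2].
Qed.

(** Uniform boundedness of all entries on [[0, L]]. *)
Definition mxbounded p q (F : R -> 'M[C]_(p, q)) := 
  exists2 K, 0 <= K & forall x, 0 <= x <= L -> forall i j, cabs (F x i j) <= K.

Lemma mxboundedP p q (F : R -> 'M[C]_(p, q)) :
  (forall i j, exists K, forall x, 0 <= x <= L -> cabs (F x i j) <= K) ->
  mxbounded F.
Proof.
move=> /(_ _)/choice H. 
have {H} [K HK] : exists K : 'I_p -> 'I_q -> R, forall i j x, 0 <= x <= L ->
  cabs (F x i j) <= K i j.
  have /choice [K HK] : forall i, exists K : 'I_q -> R, forall j x,
    0 <= x <= L -> cabs (F x i j) <= K j.
    by move=> i; have [K HK] := H i; exists K.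
  by exists K.
exists (\sum_i \sum_j `|K i j|); first by do 2 apply: sumr_ge0 => ? _.
move=> x xL i j; apply: (le_trans (HK _ _ _ xL)).
rewrite (bigD1 i)//= (bigD1 j)//= -addrA; apply: ler_wpDr; last exact: ler_norm.
by rewrite addr_ge0//; do ?apply: sumr_ge0 => ? _ //; rewrite sumr_ge0.
Qed.

Lemma mxAC_bounded p q (F : R -> 'M[C]_(p, q)) : 0 <= L ->
  mxabs_continuous L F ->
  mxbounded F.
Proof. by move=> L0 HF; apply: mxboundedP => i j;
  exact: abs_continuous_bounded. Qed.

Lemma mxboundedM p q r (F : R -> 'M[C]_(p, q)) (G : R -> 'M[C]_(q, r)) :
  mxbounded F -> mxbounded G -> mxbounded (fun x => F x *m G x).
Proof.
move=> [K1 K10 H1] [K2 K20 H2]; exists (q%:R * (K1 * K2)).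
  by rewrite !mulr_ge0.
move=> x xL i j; rewrite mxE; apply: le_trans (cabs_sum _ _ _) _.
rewrite mulr_natl -[in leRHS](card_ord q) -sumr_const; apply: ler_sum => k _.
by rewrite cabsM; apply: ler_pM; rewrite ?cabs_ge0 ?H1 ?H2.
Qed.

Lemma deriv_on_bounded (f : R -> R) : 0 <= L ->
  (forall x, 0 <= x <= L -> exists l, is_deriv_on L f x l) ->
  exists K, forall x, 0 <= x <= L -> `|f x| <= K.
Proof.
move=> L0 Hf.
apply: (@interval_induction R
  (fun a b => exists K, forall x, a <= x <= b -> `|f x| <= K) 0 L) => //.
- move=> a b c _ _ _ _ [K1 H1] [K2 H2];
  exists (Num.max K1 K2) => x /andP[ax xc].
  rewrite le_max; have [xb|bx] := leP x b; first by rewrite H1// ax xb.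
  by rewrite H2 ?orbT// (ltW bx).
- move=> x x0 xL; have [|l /is_deriv_onP Hl] := Hf x; first by rewrite x0.
  have [d d0 Hd] := Hl 1 ltr01; exists d => // a b a0 ax xb bL da bd.
  exists (`|f x| + (1 + `|l|) * d) => y /andP[ay yb].
  have yd : `|y - x| < d by rewrite lter_norml; apply/andP; split;
    clear -ay yb da bd; lra.
  have yL : 0 <= y <= L by rewrite (le_trans a0 ay) (le_trans yb bL).
  have := Hd _ yL yd => h.
  rewrite -(subrK (f x) (f y)) -[f y - f x](subrK (l * (y - x))).
  apply: le_trans (ler_normD _ _) _; rewrite [leRHS]addrC lerD2r.
  apply: le_trans (ler_normD _ _) _; rewrite mulrDl normrM.
  apply: lerD; last by rewrite ler_wpM2l// ltW.
  by apply: le_trans h _; rewrite !mul1r ltW.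
Qed.

Lemma mxderiv_bounded p q (F D : R -> 'M[C]_(p, q)) : 0 <= L ->
  (forall x, 0 <= x <= L -> is_mxderiv_on L F x (D x)) -> mxbounded F.
Proof.
move=> L0 HF; apply: mxboundedP => i j.
have [|K1 H1] := deriv_on_bounded (f := fun x => Re (F x i j)) L0.
  by move=> x xL; exists (Re (D x i j)); have [] := HF x xL i j.
have [|K2 H2] := deriv_on_bounded (f := fun x => Im (F x i j)) L0.
  by move=> x xL; exists (Im (D x i j)); have [] := HF x xL i j.
exists (K1 + K2) => x xL; apply: le_trans (cabs_le _) _.
by apply: lerD; [exact: H1|exact: H2].
Qed.

Lemma mxderiv_AC p q (F D : R -> 'M[C]_(p, q)) : 
  (forall x, 0 <= x <= L -> is_mxderiv_on L F x (D x)) -> mxbounded D ->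
  mxabs_continuous L F.
Proof.
move=> HF [K K0 HK] i j; apply/abs_continuousP; split;
  apply: (@real_AC_lip _ _ _ K); apply: deriv_on_lipschitz => x xL.
  exists (Re (D x i j)); first by have [] := HF x xL i j.
  by apply: le_trans (Re_le_cabs _) _; exact: HK.
exists (Im (D x i j)); first by have [] := HF x xL i j.
by apply: le_trans (Im_le_cabs _) _; exact: HK.
Qed.
End ComplexCalculus.

(** * Gronwall estimates and the fundamental matrix *)

Section Gronwall.
Context {R : realType}.
Local Notation C := R[i].
Local Notation Re := (@complex.Re R).
Local Notation Im := (@complex.Im R).
Variable L : R.

Lemma is_deriv_expRM (k x : R) :
  is_deriv_on L (fun y => expR (k * y)) x (k * expR (k * x)).
Proof.
have H : is_derive x 1 (fun y => expR (k * y)) (k * expR (k * x)).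
  have H1 : is_derive x 1 (fun y => k * y) k.
    have := is_deriveZ k (is_derive_id x 1); rewrite /GRing.scale/= mulr1;
      exact.
  have := @is_derive1_comp _ expR (fun y => k * y) x _ _ (is_derive_expR _) H1.
  by rewrite /GRing.scale/= mulrC.
have [dH <-] := H; rewrite -derive1E; exact: derivable_is_deriv_on.
Qed.

Lemma real_AC_expRM (k : R) : 0 <= L -> real_AC L (fun y => expR (k * y)).
Proof.
move=> L0; apply: (@real_AC_lip _ _ _ (`|k| * expR (`|k| * L))).
apply: deriv_on_lipschitz => x /andP[x0 xL].
exists (k * expR (k * x)); first exact: is_deriv_expRM.
rewrite normrM (ger0_norm (expR_ge0 _)) ler_wpM2l// ler_expR.
apply: le_trans (ler_norm _) _; rewrite normrM (ger0_norm x0).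
by rewrite ler_wpM2l.
Qed.

(** The square of the Euclidean norm of a complex column vector. *)
Definition sqn n (v : 'cV[C]_n) : R := \sum_i cabs (v i 0) ^+ 2.

Lemma sqn_ge0 n (v : 'cV[C]_n) : 0 <= sqn v.
Proof. by apply: sumr_ge0 => i _; rewrite sqr_ge0. Qed.

Lemma sqn0 n : sqn (0 : 'cV[C]_n) = 0.
Proof.
by rewrite /sqn big1// => i _; rewrite mxE ComplexField.Normc.normc0 expr0n.
Qed.

Lemma sqn_eq0 n (v : 'cV[C]_n) : sqn v <= 0 -> v = 0.
Proof.
move=> v0; have : sqn v == 0 by rewrite eq_le v0 sqn_ge0.
rewrite /sqn psumr_eq0; last by move=> i _; rewrite sqr_ge0.
move=> /allP H; apply/matrixP => i j; rewrite (ord1 j) mxE.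
have := H i (mem_index_enum _); rewrite sqrf_eq0 => /eqP.
exact: ComplexField.Normc.eq0_normc.
Qed.

Lemma cabs_sqn n (v : 'cV[C]_n) i : cabs (v i 0) ^+ 2 <= sqn v.
Proof.
rewrite /sqn (bigD1 i)//= lerDl; apply: sumr_ge0 => j _; exact: sqr_ge0.
Qed.

Lemma is_deriv_sum I (r : seq I) (F : I -> R -> R) x (D : I -> R) :
  (forall i, is_deriv_on L (F i) x (D i)) ->
  is_deriv_on L (fun y => \sum_(i <- r) F i y) x (\sum_(i <- r) D i).
Proof.
move=> H; elim: r => [|i r IHr].
  by rewrite big_nil; under eq_fun do rewrite big_nil; exact: is_deriv_cst.
by rewrite big_cons; under eq_fun do rewrite big_cons; exact: is_derivD.
Qed.

Lemma real_AC_sum I (r : seq I) (F : I -> R -> R) :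
  (forall i, real_AC L (F i)) -> real_AC L (fun y => \sum_(i <- r) F i y).
Proof.
move=> H; elim: r => [|i r IHr].
  by under eq_fun do rewrite big_nil; exact: real_AC_cst.
by under eq_fun do rewrite big_cons; exact: (real_ACD (H i) IHr).
Qed.

(** The derivative of [sqn] at [v] in the direction [d]. *)
Definition dsqn n (v d : 'cV[C]_n) : R :=
  \sum_i 2 * (Re (v i 0) * Re (d i 0) + Im (v i 0) * Im (d i 0)).

Lemma is_deriv_sqn n (w : R -> 'cV[C]_n) x d : is_mxderiv_on L w x d ->
  is_deriv_on L (fun y => sqn (w y)) x (dsqn (w x) d).
Proof.
move=> Hw; apply: is_deriv_sum => i; have [Hr Hi] := Hw i 0.
rewrite (_ : (fun y => _) = (fun y => Re (w y i 0) * Re (w y i 0) +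
  Im (w y i 0) * Im (w y i 0))); last first.
  by apply/funext => y; rewrite sqr_cabs !expr2.
rewrite (_ : 2 * _ = (Re (d i 0) * Re (w x i 0) + Re (w x i 0) * Re (d i 0)) +
  (Im (d i 0) * Im (w x i 0) + Im (w x i 0) * Im (d i 0))); last by ring.
by apply: is_derivD; exact: is_derivM.
Qed.

Lemma real_AC_sqn n (w : R -> 'cV[C]_n) : 0 <= L -> mxabs_continuous L w ->
  real_AC L (fun y => sqn (w y)).
Proof.
move=> L0 Hw; apply: (@real_AC_sum _ _ (fun i y => cabs (w y i 0) ^+ 2)) => i.
rewrite (_ : (fun y => _) = (fun y => Re (w y i 0) * Re (w y i 0) +
  Im (w y i 0) * Im (w y i 0))); last first.
  by apply/funext => y; rewrite sqr_cabs !expr2.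
have /abs_continuousP[hr hi] := Hw i 0.
exact: (real_ACD (real_ACM L0 hr hr) (real_ACM L0 hi hi)).
Qed.

Lemma dsqn_le n (A : 'M[C]_n) (v : 'cV[C]_n) K : 0 <= K ->
  (forall i j, cabs (A i j) <= K) ->
  `|dsqn v (A *m v)| <= 2 * n%:R * K * sqn v.
Proof.
move=> K0 HA; apply: le_trans (ler_norm_sum _ _ _) _.
apply: (@le_trans _ _ (\sum_(i < n) \sum_(j < n)
    K * (cabs (v i 0) ^+ 2 + cabs (v j 0) ^+ 2))); last first.
  under eq_bigr do rewrite -mulr_sumr big_split/= sumr_const card_ord.
  rewrite -mulr_sumr big_split/= sumr_const card_ord sumrMnl -/(sqn v).
  by rewrite -(mulr_natr (sqn v) n) le_eqVlt; apply/orP; left; apply/eqP; ring.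
apply: ler_sum => i _.
have h : forall z u : C, `|2 * (Re z * Re u + Im z * Im u)|
  <= 2 * (cabs z * cabs u).
  move=> z u; rewrite normrM ger0_norm// ler_wpM2l//.
  rewrite (_ : Re z * Re u + _ = Re (z * conjc u)); last first.
    by case: z; case: u => /= a b c d; ring.
  apply: le_trans (Re_le_cabs _) _; rewrite cabsM ler_wpM2l ?cabs_ge0//.
  by case: u => a b /=; rewrite sqrrN.
apply: le_trans (h _ _) _; rewrite mxE.
apply: (@le_trans _ _ (2 * (cabs (v i 0) * \sum_j (K * cabs (v j 0))))).
  rewrite ler_wpM2l// ler_wpM2l ?cabs_ge0//; apply: le_trans (cabs_sum _ _ _) _.
  by apply: ler_sum => j _; rewrite cabsM ler_wpM2r ?cabs_ge0.
rewrite !mulr_sumr; apply: ler_sum => j _.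
(* [2 a b <= a^2 + b^2] *)
set a := cabs (v i 0); set b := cabs (v j 0).
have -> : 2 * (a * (K * b)) = K * (2 * a * b) by ring.
rewrite ler_wpM2l// -subr_ge0 (_ : _ - _ = (a - b) ^+ 2) ?sqr_ge0//; by ring.
Qed.

(** The two exponential bounds express that the squared norm of a solution of
    [w' = A w] can neither grow nor decay faster than exponentially. *)
Lemma gronwall n (w : R -> 'cV[C]_n) (A : R -> 'M[C]_n) K : 0 <= L ->
  mxabs_continuous L w -> 0 <= K ->
  (forall x, 0 <= x <= L -> forall i j, cabs (A x i j) <= K) ->
  ae_on L (fun x => is_mxderiv_on L w x (A x *m w x)) ->
  let k := 2 * n%:R * K in forall a b, 0 <= a -> a <= b -> b <= L ->
    expR (- k * b) * sqn (w b) <= expR (- k * a) * sqn (w a) /\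
    expR (k * a) * sqn (w a) <= expR (k * b) * sqn (w b).
Proof.
move=> L0 Hw K0 HK Hae k a b a0 ab bL.
have xL x : 0 < x < L -> 0 <= x <= L by move=> /andP[/ltW -> /ltW ->].
split.
  apply: (real_AC_le (f := fun x => expR (- k * x) * sqn (w x)) _ a0 ab bL).
    exact: (real_ACM L0 (real_AC_expRM _ L0) (real_AC_sqn L0 Hw)).
  apply: ae_onS Hae => x xI H.
  exists (- k * expR (- k * x) * sqn (w x) +
         expR (- k * x) * dsqn (w x) (A x *m w x)).
    by apply: is_derivM; [exact: is_deriv_expRM|exact: is_deriv_sqn].
  rewrite (_ : _ + _ = expR (- k * x) * (- k * sqn (w x) + dsqn (w x) (A x *m w
    x))); last by ring.
  rewrite mulr_ge0_le0 ?expR_ge0//.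
  have := dsqn_le (w x) K0 (HK _ (xL _ xI)).
  by rewrite -/k ler_norml => /andP[_]; clear; lra.
rewrite -lerN2.
apply: (real_AC_le (f := fun x => - (expR (k * x) * sqn (w x))) _ a0 ab bL).
  under eq_fun do rewrite -mulN1r.
  exact: (real_ACM L0 (@real_AC_cst _ L (-1)) (real_ACM L0 (real_AC_expRM _ L0)
    (real_AC_sqn L0 Hw))).
apply: ae_onS Hae => x xI H.
exists (- (k * expR (k * x) * sqn (w x) +
       expR (k * x) * dsqn (w x) (A x *m w x))).
  by apply: is_derivN; apply: is_derivM; [exact: is_deriv_expRM|exact:
    is_deriv_sqn].
rewrite (_ : _ + _ = expR (k * x) * (k * sqn (w x) + dsqn (w x) (A x *m w x)));
  last by ring.
rewrite oppr_le0 mulr_ge0 ?expR_ge0//.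
have := dsqn_le (w x) K0 (HK _ (xL _ xI)).
by rewrite -/k ler_norml => /andP[+ _]; clear; lra.
Qed.

Lemma gronwall_eq0 n (w : R -> 'cV[C]_n) (A : R -> 'M[C]_n) : 0 <= L ->
  mxabs_continuous L w -> mxbounded L A ->
  ae_on L (fun x => is_mxderiv_on L w x (A x *m w x)) ->
  w 0 = 0 -> forall x, 0 <= x <= L -> w x = 0.
Proof.
move=> L0 Hw [K K0 HK] Hae w0 x /andP[x0 xL].
have [+ _] := gronwall L0 Hw K0 HK Hae (lexx 0) x0 xL.
rewrite w0 sqn0 mulr0 pmulr_rle0 ?expR_gt0//; exact: sqn_eq0.
Qed.

End Gronwall.

Section Fundamental.
Context {R : realType}.
Local Notation C := R[i].
Variables (L : R) (n : nat) (A U : R -> 'M[C]_n).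
Hypothesis L0 : 0 <= L.
Hypothesis Abnd : mxbounded L A.
Hypothesis U0 : U 0 = 1%:M.
Hypothesis UD : forall x, 0 <= x <= L -> is_mxderiv_on L U x (A x *m U x).

Lemma fund_bounded : mxbounded L U.
Proof. exact: mxderiv_bounded L0 UD. Qed.

Lemma fund_AC : mxabs_continuous L U.
Proof. apply: (mxderiv_AC UD); apply: mxboundedM => //; exact: fund_bounded.
  Qed.

Lemma fund_deriv (c : 'cV[C]_n) x : 0 <= x <= L ->
  is_mxderiv_on L (fun y => U y *m c) x (A x *m (U x *m c)).
Proof. by move=> xL; rewrite mulmxA; apply: is_mxderivMr; exact: UD. Qed.

Lemma fund_solAC (c : 'cV[C]_n) : mxabs_continuous L (fun y => U y *m c).
Proof. exact: (mxACM L0 fund_AC (mxAC_cst _ _)). Qed.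

(** A lower bound that is uniform in [x]: it yields both the invertibility
    of [U x] and the boundedness of the inverse, without differentiating the
    determinant. *)
Lemma fund_lower : exists2 k : R, 0 <= k & forall x (c : 'cV[C]_n),
  0 <= x <= L ->
  sqn c <= k * sqn (U x *m c).
Proof.
have [K K0 HK] := Abnd; pose k := 2 * n%:R * K.
have k0 : 0 <= k by rewrite !mulr_ge0.
exists (expR (k * L)); first exact: expR_ge0.
move=> x c /andP[x0 xL].
have Hae : ae_on L (fun y => is_mxderiv_on L (fun y => U y *m c) y (A y *m (U y
  *m c))).
  apply: ae_onW => y /andP[y0 yL].
  by apply: fund_deriv; rewrite !ltW.
have [_] := gronwall L0 (fund_solAC c) K0 HK Hae (lexx 0) x0 xL.
rewrite U0 mul1mx mulr0 expR0 mul1r -/k => /le_trans; apply.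
by rewrite ler_wpM2r ?sqn_ge0// ler_expR ler_wpM2l.
Qed.

Lemma fund_unit x : 0 <= x <= L -> U x \in unitmx.
Proof.
move=> xL; have [k k0 Hk] := fund_lower.
rewrite -unitmx_tr -row_free_unit -kermx_eq0; apply/eqP/row_matrixP => i.
rewrite row0; apply: trmx_inj; rewrite trmx0; apply: sqn_eq0.
apply: le_trans (Hk _ _ xL) _.
rewrite (_ : U x *m _ = (row i (kermx (U x)^T *m (U x)^T))^T); last first.
  by rewrite row_mul trmx_mul trmxK.
by rewrite mulmx_ker row0 trmx0 sqn0 mulr0.
Qed.

Lemma fund_inv_bounded : mxbounded L (fun x => invmx (U x)).
Proof.
have [k k0 Hk] := fund_lower.
(* The squared entries are at most [k n]; the square root is avoided by
   [t <= max 1 (t^2)]. *)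
exists (1 + k * n%:R); first by rewrite addr_ge0// mulr_ge0.
move=> x xL i j; set V := invmx (U x).
have := Hk x (col j V) xL.
rewrite [in U x *m _]colE mulmxA mulmxV ?fund_unit// mul1mx => h.
have {}h : cabs (V i j) ^+ 2 <= k * n%:R.
  have := cabs_sqn (col j V) i; rewrite mxE => /le_trans; apply.
  apply: le_trans h _; apply: ler_wpM2l => //.
  rewrite /sqn -[in leRHS](card_ord n) -sumr_const; apply: ler_sum => l _.
  rewrite !mxE; case: andP => _ /=.
    by rewrite expr1n expr0n addr0 sqrtr1 expr1n.
  by rewrite expr0n addr0 sqrtr0 expr0n.
have [h1|h1] := leP (cabs (V i j)) 1.
  by apply: le_trans h1 _; rewrite lerDl mulr_ge0.
apply: (@le_trans _ _ (cabs (V i j) ^+ 2)); last by apply: le_trans h _;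
  rewrite lerDr.
by rewrite expr2 ler_peMl ?cabs_ge0// ltW.
Qed.

(** With [V] the inverse of [U], the entries of [V] are Lipschitz, since
    [V(y) - V(x) = - V(y) (U(y) - U(x)) V(x)]. *)
Lemma fund_inv_AC : mxabs_continuous L (fun x => invmx (U x)).
Proof.
have [K K0 HK] := fund_inv_bounded.
have [M M0 HM] : mxbounded L (fun x => A x *m U x).
  by apply: mxboundedM => //; exact: fund_bounded.
have HU x y i j : 0 <= x <= L -> 0 <= y <= L ->
    cabs (U y i j - U x i j) <= (M + M) * `|y - x|.
  move=> xL yL; apply: le_trans (cabs_le _) _; rewrite mulrDl ReD ReN ImD ImN.
  apply: lerD.
    apply: (deriv_on_lipschitz (L := L) (f :=
      fun z => complex.Re (U z i j))) => // z zL.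
    exists (complex.Re ((A z *m U z) i j)); first by have [] := UD zL i j.
    by apply: le_trans (Re_le_cabs _) (HM _ zL _ _).
  apply: (deriv_on_lipschitz (L := L) (f :=
    fun z => complex.Im (U z i j))) => // z zL.
  exists (complex.Im ((A z *m U z) i j)); first by have [] := UD zL i j.
  by apply: le_trans (Im_le_cabs _) (HM _ zL _ _).
pose N := n%:R * (n%:R * (K * (M + M)) * K) : R.
suff HV x y i j : 0 <= x <= L -> 0 <= y <= L ->
    cabs (invmx (U y) i j - invmx (U x) i j) <= N * `|y - x|.
  move=> i j; apply/abs_continuousP; split;
    apply: (@real_AC_lip _ _ _ N) => x y xL yL.
    by rewrite -ReN -ReD; apply: le_trans (Re_le_cabs _) (HV _ _ _ _ xL yL).
  by rewrite -ImN -ImD; apply: le_trans (Im_le_cabs _) (HV _ _ _ _ xL yL).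
move=> xL yL.
have -> : invmx (U y) i j - invmx (U x) i j =
    - (invmx (U y) *m (U y - U x) *m invmx (U x)) i j.
  rewrite mulmxBr mulVmx ?fund_unit// mulmxBl mul1mx -mulmxA mulmxV
    ?fund_unit//.
  by rewrite mulmx1 !mxE opprB.
rewrite cabsN mxE; apply: le_trans (cabs_sum _ _ _) _.
have sumc (c : R) : n%:R * c = \sum_(k < n) c by rewrite sumr_const card_ord
  mulr_natl.
rewrite (_ : N * _ = n%:R * (n%:R * (K * ((M + M) * `|y - x|)) * K));
  last first.
  by rewrite /N; ring.
rewrite sumc.
apply: ler_sum => k _; rewrite cabsM.
apply: ler_pM; rewrite ?cabs_ge0 ?HK// mxE.
apply: le_trans (cabs_sum _ _ _) _.
rewrite sumc.
apply: ler_sum => l _; rewrite cabsM.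
by apply: ler_pM; rewrite ?cabs_ge0 ?HK// !mxE HU.
Qed.
End Fundamental.

(** * Primitives and complex-valued integrals *)

Section Primitive.
Context {R : realType}.
Local Notation mu := (@lebesgue_measure R).
Variable L : R.
Local Notation D := (`]0, L[%classic : set R).
Implicit Types (f : R -> R).

(** The primitive of [f] restricted to [(0, L)], integrated from minus
    infinity, so that it is constant on both sides of [(0, L)]. *)
Definition primitive f (x : R) : R := \int[mu]_(t in `]-oo, x]) (f \_ D) t.

Lemma integrable_patch f : mu.-integrable D (EFin \o f) ->
  mu.-integrable setT (EFin \o (f \_ D)).
Proof.
move=> intf; rewrite -restrict_EFin; apply/integrable_restrict => //=.
by rewrite setTI.
Qed.

Lemma integrable_patchS f (A : set R) : measurable A ->
  mu.-integrable D (EFin \o f) ->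
  mu.-integrable A (EFin \o (f \_ D)).
Proof.
by move=> mA /integrable_patch; apply: integrableS.
Qed.

Lemma primitiveB f x y : mu.-integrable D (EFin \o f) -> x <= y ->
  primitive f y - primitive f x = \int[mu]_(t in `]x, y[) (f \_ D) t.
Proof.
move=> intf xy; rewrite /primitive Rintegral_itvB ?bnd_simp//.
  by rewrite Rintegral_itv_bndo_bndc//; exact: integrable_patchS.
exact: integrable_patchS.
Qed.

(** Absolute continuity of the Lebesgue integral, applied to the union of
    the given intervals. *)
Lemma primitive_AC f : mu.-integrable D (EFin \o f) -> real_AC L (primitive f).
Proof.
move=> intf e e0.
have [d [d0 Hd]] := integral_normr_continuous (integrable_patch intf) e0.
exists d => // N a b Hab tI sd.
pose F i := `]a i, b i[%classic : set R.
have mF i : @measurable _ (measurableTypeR R) (F i) by exact: measurable_itv.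
have ab i : a i <= b i by have [] := Hab i.
have mUF : @measurable _ (measurableTypeR R) (\big[setU/set0]_(i < N) F i) by
  exact: bigsetU_measurable.
have muF i : mu (F i) = (b i - a i)%:E.
  rewrite /F lebesgue_measure_itv/= lte_fin; case: ltP => [_|ba];
    first by rewrite EFinB.
  by congr EFin; apply/eqP; rewrite eq_sym subr_eq0 eq_le ba ab.
have muU : (mu (\big[setU/set0]_(i < N) F i) < d%:E)%E.
  rewrite measure_bigsetU_ord// (eq_bigr (fun i => (b i - a i)%:E)).
    by rewrite sumEFin lte_fin.
  by move=> i _; exact: muF.
apply: le_lt_trans (Hd _ mUF muU).
have int1 : mu.-integrable setT (EFin \o (fun x => `|(f \_ D) x|)).
  by apply: (integrable_norm (integrable_patch intf)).
rewrite /Rintegral integral_bigsetU_EFin//; last 3 first.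
- exact: index_enum_uniq.
- exact: sub_trivIset tI.
- apply: (measurable_funS measurableT) => //; exact: (measurable_int mu int1).
rewrite -sum_fine; last first.
  move=> i _.
  have i1 := integrableS measurableT (mF i) (@subsetT _ _) int1.
  exact: (integrable_fin_num _ i1).
apply: ler_sum => i _; rewrite primitiveB//.
by apply: le_normr_Rintegral => //; exact: integrable_patchS.
Qed.

(** Lebesgue's differentiation theorem. *)
Lemma primitive_deriv f : mu.-integrable D (EFin \o f) ->
  ae_on L (fun x => is_deriv_on L (primitive f) x (f x)).
Proof.
move=> intf.
have locf : locally_integrable setT (f \_ D) by exact: integrable_locally.
have int y : mu.-integrable `]-oo, y] (EFin \o (f \_ D)) by exact:
  integrable_patchS.
have FF := ae_filter_ringOfSetsType mu.
have := FTC1Ny int locf; rewrite /ae_on; apply: filterS => x [dx ex] xI.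
rewrite (_ : f x = (f \_ D) x); last by rewrite patchE mem_set.
by rewrite -ex; exact: derivable_is_deriv_on.
Qed.

Lemma primitiveE f x : mu.-integrable D (EFin \o f) ->
  primitive f x = \int[mu]_(t in D) (if t < x then f t else 0).
Proof.
move=> intf; rewrite /primitive -Rintegral_itv_bndo_bndc;
  last exact: integrable_patchS.
rewrite Rintegral_mkcond [RHS]Rintegral_mkcond; apply: eq_Rintegral => t _.
rewrite !patchE !mem_setE !in_itv/=.
by case: (t < x); case: (_ && _).
Qed.

Lemma primitive_end f x : mu.-integrable D (EFin \o f) -> L <= x ->
  primitive f x = \int[mu]_(t in D) f t.
Proof.
move=> intf Lx; rewrite primitiveE//; apply: eq_Rintegral => t.
by rewrite mem_setE in_itv/= => /andP[_ /lt_le_trans/(_ Lx) ->].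
Qed.

Lemma primitive_start f x : mu.-integrable D (EFin \o f) -> x <= 0 ->
  primitive f x = 0.
Proof.
move=> intf x0; rewrite primitiveE// -[RHS](mul0r (fine (mu D)))
  -Rintegral_cst//; apply: eq_Rintegral => t.
by rewrite mem_setE in_itv/= => /andP[t0 _];
  rewrite ltNge (le_trans x0 (ltW t0)).
Qed.
End Primitive.

Section ComplexMeasurable.
Context {R : realType} d (T : measurableType d).
Local Notation C := R[i].
Local Notation Re := (@complex.Re R).
Local Notation Im := (@complex.Im R).
Variable D : set T.
Implicit Types (f g h : T -> C).

(** Measurability of a complex-valued function, through its real and
    imaginary parts. *)
Definition cmeasurable h := measurable_fun D (fun x => Re (h x)) /\
  measurable_fun D (fun x => Im (h x)).

Lemma cmeasurable_cst (k : C) : cmeasurable (fun=> k).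
Proof. by split; exact: measurable_cst. Qed.

Lemma cmeasurableD f g : cmeasurable f -> cmeasurable g ->
  cmeasurable (fun x => f x + g x).
Proof.
move=> [fr fi] [gr gi]; split.
  have -> : (fun x => Re (f x + g x)) = (fun x => Re (f x) + Re (g x)).
    by apply/funext => x; rewrite ReD.
  exact: measurable_funD.
have -> : (fun x => Im (f x + g x)) = (fun x => Im (f x) + Im (g x)).
  by apply/funext => x; rewrite ImD.
exact: measurable_funD.
Qed.

Lemma cmeasurableM f g : cmeasurable f -> cmeasurable g ->
  cmeasurable (fun x => f x * g x).
Proof.
move=> [fr fi] [gr gi]; split.
  have -> : (fun x => Re (f x * g x)) =
      (fun x => Re (f x) * Re (g x) - Im (f x) * Im (g x)).
    by apply/funext => x; rewrite ReM.
  by apply: measurable_funB; exact: measurable_funM.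
have -> : (fun x => Im (f x * g x)) =
    (fun x => Re (f x) * Im (g x) + Im (f x) * Re (g x)).
  by apply/funext => x; rewrite ImM.
by apply: measurable_funD; exact: measurable_funM.
Qed.

Lemma cmeasurable_cabs f : cmeasurable f ->
  measurable_fun D (fun x => cabs (f x)).
Proof.
move=> [fr fi].
have -> : (fun x => cabs (f x)) = (fun x => Num.sqrt (Re (f x) ^+ 2 + Im (f x)
  ^+ 2)).
  by apply/funext => x; case: (f x).
apply: (measurableT_comp (f := @Num.sqrt R)).
  apply: continuous_measurable_fun; exact: sqrt_continuous.
by apply: measurable_funD; exact: measurable_funX.
Qed.

Lemma cmeasurable_sum I (r : seq I) (F : I -> T -> C) :
  (forall i, cmeasurable (F i)) -> cmeasurable (fun x => \sum_(i <- r) F i x).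
Proof.
move=> H; elim: r => [|i r IHr].
  rewrite (_ : (fun x => _) = fun=> 0); first exact: cmeasurable_cst.
  by apply/funext => x; rewrite big_nil.
rewrite (_ : (fun x => _) = fun x => F i x + \sum_(i <- r) F i x).
  exact: (cmeasurableD (H i) IHr).
by apply/funext => x; rewrite big_cons.
Qed.

End ComplexMeasurable.

Section ComplexIntegral.
Context {R : realType}.
Local Notation mu := (@lebesgue_measure R).
Local Notation C := R[i].
Local Notation Re := (@complex.Re R).
Local Notation Im := (@complex.Im R).
Variable L : R.
Local Notation D := (`]0, L[%classic : set R).
Implicit Types (f g h : R -> C).

(** Lebesgue integrability on [(0, L)] of a complex-valued function. *)
Definition cintegrable h := mu.-integrable D (EFin \o (fun x => Re (h x))) /\
  mu.-integrable D (EFin \o (fun x => Im (h x))).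

(** The complex-valued integral over [(0, L)]. *)
Definition cint h : C :=
  Complex (\int[mu]_(t in D) Re (h t)) (\int[mu]_(t in D) Im (h t)).

Lemma cintegrableP h : cintegrable h <-> cmeasurable D h /\
  mu.-integrable D (EFin \o (fun x => cabs (h x))).
Proof.
split=> [[hr hi]|[mh hint]].
  have mh : cmeasurable D h.
    split; apply/measurable_EFinP.
      exact: (measurable_int mu hr).
    exact: (measurable_int mu hi).
  split=> //.
  apply: (@le_integrable _ _ _ mu D _ _ (EFin \o (fun x => `|Re (h x)|
    + `|Im (h x)|))) => //.
  - by apply/measurable_EFinP; exact: cmeasurable_cabs.
  - move=> x _ /=; rewrite lee_fin (ger0_norm (cabs_ge0 _)).
    by apply: le_trans (cabs_le _) (ler_norm _).
  - rewrite (_ : EFin \o _ = (fun x => `|Re (h x)|%:E) \+ (fun x => `|Im (h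
    x)|%:E))%E//.
    by apply: integrableD => //; apply: integrable_norm.
have [mr mi] := mh.
split; apply: le_integrable hint => //.
- exact/measurable_EFinP.
- by move=> x _ /=; rewrite lee_fin (ger0_norm (cabs_ge0 _)) Re_le_cabs.
- exact/measurable_EFinP.
- by move=> x _ /=; rewrite lee_fin (ger0_norm (cabs_ge0 _)) Im_le_cabs.
Qed.

Lemma cintegrable0 : cintegrable (fun=> 0).
Proof. by split; apply: (integrable0). Qed.

Lemma cintegrableD f g : cintegrable f -> cintegrable g ->
  cintegrable (fun x => f x + g x).
Proof.
move=> [fr fi] [gr gi]; split.
  rewrite (_ : EFin \o _ = (EFin \o (fun x => Re (f x))) \+ (EFin \o (fun x
    => Re (g x))))%E.
    exact: integrableD.
  by apply/funext => x /=; rewrite ReD EFinD.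
rewrite (_ : EFin \o _ = (EFin \o (fun x => Im (f x))) \+ (EFin \o (fun x => Im
  (g x))))%E.
  exact: integrableD.
by apply/funext => x /=; rewrite ImD EFinD.
Qed.

Lemma cintegrableMb f h : cmeasurable D h ->
  (exists K, forall x, 0 < x < L -> cabs (h x) <= K) -> cintegrable f ->
  cintegrable (fun x => h x * f x).
Proof.
move=> mh [K HK] /cintegrableP[mf intf]; apply/cintegrableP; split.
  exact: cmeasurableM.
apply: (@le_integrable _ _ _ mu D _ _ (EFin \o (fun x => K * cabs (f x))))
  => //.
- by apply/measurable_EFinP; apply: cmeasurable_cabs; exact: cmeasurableM.
- move=> x /=; rewrite in_itv/= => xI; rewrite lee_fin cabsM !normrM.
  rewrite ler_wpM2r// ger0_norm ?cabs_ge0//.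
  by apply: le_trans (HK _ xI) (ler_norm _).
- rewrite (_ : EFin \o _ = (fun x => K%:E * (cabs (f x))%:E))%E//.
  exact: integrableZl.
Qed.

Lemma cintegrableZ (k : C) f : cintegrable f -> cintegrable (fun x => k * f x).
Proof.
move=> intf; apply: (@cintegrableMb f (fun=> k)) => //.
by exists (cabs k).
Qed.

Lemma cintD f g : cintegrable f -> cintegrable g ->
  cint (fun x => f x + g x) = cint f + cint g.
Proof.
move=> [fr fi] [gr gi]; rewrite /cint.
apply/eqP; rewrite eq_complex /= -!RintegralD//; apply/andP; split; apply/eqP.
  by apply: eq_Rintegral => t _; rewrite ReD.
by apply: eq_Rintegral => t _; rewrite ImD.
Qed.

Lemma cintZ (k : C) f : cintegrable f ->
  cint (fun x => k * f x) = k * cint f.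
Proof.
move=> [fr fi].
have ZZ (c : R) (u : R -> R) : mu.-integrable D (EFin \o u) ->
    mu.-integrable D (EFin \o (fun x => c * u x)).
  move=> ig; rewrite (_ : EFin \o _ = (fun x => c%:E * (u x)%:E))%E//.
  exact: integrableZl.
rewrite /cint; apply/eqP; rewrite eq_complex /=; case: k => a b /=.
rewrite -!RintegralZl// -RintegralB ?ZZ// -RintegralD ?ZZ//.
apply/andP; split; apply/eqP.
  by apply: eq_Rintegral => t _; rewrite ReM.
by apply: eq_Rintegral => t _; rewrite ImM /= addrC.
Qed.

Lemma cintegrable_sum I (r : seq I) (F : I -> R -> C) :
  (forall i, cintegrable (F i)) -> cintegrable (fun x => \sum_(i <- r) F i x).
Proof.
move=> H; elim: r => [|i r IHr].
  by under eq_fun do rewrite big_nil; exact: cintegrable0.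
by under eq_fun do rewrite big_cons; exact: (cintegrableD (H i) IHr).
Qed.

Lemma cint_sum I (r : seq I) (F : I -> R -> C) :
  (forall i, cintegrable (F i)) ->
  cint (fun x => \sum_(i <- r) F i x) = \sum_(i <- r) cint (F i).
Proof.
move=> H; elim: r => [|i r IHr].
  rewrite big_nil; under eq_fun do rewrite big_nil.
  by rewrite /cint/= !Rintegral_cst// !mul0r.
rewrite big_cons; under eq_fun do rewrite big_cons.
by rewrite cintD// ?IHr//; exact: cintegrable_sum.
Qed.

(** The integral is multiplied by the unimodular [k] that makes it real and
    nonnegative; its real part is then at most the integral of the modulus. *)
Lemma cabs_cint f : cintegrable f ->
  cabs (cint f) <= \int[mu]_(t in D) cabs (f t).
Proof.
move=> intf; have [mf If] := (cintegrableP f).1 intf.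
have [->|z0] := eqVneq (cint f) 0.
  by rewrite ComplexField.Normc.normc0 Rintegral_ge0// => x _; exact: cabs_ge0.
have cz : cabs (cint f) != 0.
  by apply: contra z0 => /eqP/ComplexField.Normc.eq0_normc ->.
set z := cint f in z0 cz *.
pose k : C := conjc z * ((cabs z)^-1)%:C%C.
have nk : cabs k = 1.
  rewrite /k cabsM (_ : cabs (conjc z) = cabs z); last first.
    by case: (z) => a b /=; rewrite sqrrN.
  rewrite [X in _ * X]/= expr0n addr0 sqrtr_sqr ger0_norm ?invr_ge0 ?cabs_ge0//.
  exact: mulfV.
have kz : Re (k * z) = cabs z.
  have e1 : Re (conjc z * z) = cabs z ^+ 2.
    by rewrite sqr_cabs ReM; case: (z) => a b /=; rewrite mulNr opprK !expr2.
  rewrite /k mulrAC ReM e1.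
  rewrite (_ : Re (_%:C%C) = (cabs z)^-1)// (_ : Im (_%:C%C) = 0)//.
  by rewrite mulr0 subr0 expr2 mulfK.
rewrite -kz -cintZ//.
have [ir _] := cintegrableZ k intf.
apply: le_Rintegral => // x _.
by rewrite -[leRHS]mul1r -nk -cabsM; apply: le_trans (ler_norm _) (Re_le_cabs
  _).
Qed.

End ComplexIntegral.

(** * Square-integrable functions and Hilbert-Schmidt kernels *)

Section L2.
Context {R : realType}.
Local Notation mu := (@lebesgue_measure R).
Local Notation C := R[i].
Local Notation Re := (@complex.Re R).
Local Notation Im := (@complex.Im R).
Variable L : R.
Hypothesis L0 : 0 <= L.
Local Notation D := (`]0, L[%classic : set R).
Implicit Types (f g h : R -> C) (p q : R -> R).

Lemma measure_itv0L : mu D = L%:E.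
Proof.
rewrite lebesgue_measure_itv/= lte_fin; case: ltP => [_|Lneg];
  first by rewrite sube0.
by congr EFin; apply/eqP; rewrite eq_le L0.
Qed.

Lemma integrableZR (c : R) p : mu.-integrable D (EFin \o p) ->
  mu.-integrable D (EFin \o (fun x => c * p x)).
Proof.
move=> ig; rewrite (_ : EFin \o _ = (fun x => c%:E * (p x)%:E))%E//.
exact: integrableZl.
Qed.

Lemma integrableDR p q : mu.-integrable D (EFin \o p) ->
  mu.-integrable D (EFin \o q) ->
  mu.-integrable D (EFin \o (fun x => p x + q x)).
Proof.
move=> ip iq; rewrite (_ : EFin \o _ = (EFin \o p) \+ (EFin \o q))%E//.
exact: integrableD.
Qed.

Lemma le_integrableR p q : measurable_fun D p -> mu.-integrable D (EFin \o q) ->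
  (forall x, 0 < x < L -> `|p x| <= q x) -> mu.-integrable D (EFin \o p).
Proof.
move=> mp iq pq; apply: le_integrable iq => //; first exact/measurable_EFinP.
move=> x /=; rewrite in_itv/= => xI; rewrite lee_fin.
exact: le_trans (pq _ xI) (ler_norm _).
Qed.

Lemma integrable_cstR (c : R) : mu.-integrable D (EFin \o (fun=> c)).
Proof.
apply/integrableP; split; first exact: measurable_cst.
by rewrite /= integral_cst//= measure_itv0L -EFinM ltry.
Qed.

Lemma sqr_integrable_mul p q : measurable_fun D p -> measurable_fun D q ->
  mu.-integrable D (EFin \o (fun x => p x ^+ 2)) ->
  mu.-integrable D (EFin \o (fun x => q x ^+ 2)) ->
  mu.-integrable D (EFin \o (fun x => p x * q x)).
Proof.
move=> mp mq ip iq; apply: le_integrableR (integrableDR ip iq) _.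
  exact: measurable_funM.
move=> x _; rewrite normrM -(real_normK (num_real (p x))) -(real_normK
  (num_real (q x))).
have := sqr_ge0 (`|p x| - `|q x|); have := normr_ge0 (p x); have :=
  normr_ge0 (q x).
by set a := `|p x|; set b := `|q x|; clear; nra.
Qed.

(** The quadratic polynomial [t |-> t^2 a - 2 t I + b], the integral of
    [(t p - q)^2], is nonnegative. *)
Lemma cauchy_schwarzR p q : measurable_fun D p -> measurable_fun D q ->
  mu.-integrable D (EFin \o (fun x => p x ^+ 2)) ->
  mu.-integrable D (EFin \o (fun x => q x ^+ 2)) ->
  (\int[mu]_(x in D) (p x * q x)) ^+ 2 <=
  (\int[mu]_(x in D) (p x ^+ 2)) * (\int[mu]_(x in D) (q x ^+ 2)).
Proof.
move=> mp mq ip iq; have ipq := sqr_integrable_mul mp mq ip iq.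
set I := \int[mu]_(x in D) (p x * q x).
set a := \int[mu]_(x in D) (p x ^+ 2); set b := \int[mu]_(x in D) (q x ^+ 2).
have H t : 0 <= t ^+ 2 * a - 2 * t * I + b.
  rewrite (_ : _ + _ = t ^+ 2 * a + (- (2 * t)) * I + b); last by ring.
  rewrite /a /b /I -!RintegralZl// -!RintegralD//; last 3 first.
  - exact: integrableDR (integrableZR _ ip) (integrableZR _ ipq).
  - exact: integrableZR.
  - exact: integrableZR.
  apply: Rintegral_ge0 => x _.
  by rewrite (_ : _ + _ = (t * p x - q x) ^+ 2) ?sqr_ge0//; ring.
have a0 : 0 <= a by apply: Rintegral_ge0 => x _; exact: sqr_ge0.
(* The minimizer is [t = I / a]; for [a = 0] the polynomial is affine. *)
have [a1|a1] := ltP 0 a.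
  have e : a * ((I / a) ^+ 2 * a - 2 * (I / a) * I + b) = a * b - I ^+ 2.
    by field; rewrite gt_eqF.
  by have := mulr_ge0 (ltW a1) (H (I / a)); rewrite e subr_ge0.
have az : a = 0 by apply/eqP; rewrite eq_le a1.
rewrite az mul0r; have [->|I0] := eqVneq I 0; first by rewrite expr0n.
have := H ((b + 1) / (2 * I)); rewrite az mulr0 add0r (_ : _ + _ = -1);
  first by lra.
by field.
Qed.

Lemma L2P f : is_L2 L f <-> cmeasurable D f /\
  mu.-integrable D (EFin \o (fun x => cabs (f x) ^+ 2)).
Proof.
split=> [[mr mi fin]|[[mr mi] /integrableP[_ fin]]].
  split=> //; apply/integrableP; split.
    apply/measurable_EFinP; apply: measurable_funX.
    by apply: cmeasurable_cabs.
  apply: le_lt_trans fin; rewrite le_eqVlt; apply/orP; left; apply/eqP.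
  by apply: eq_integral => x _ /=; rewrite ger0_norm ?sqr_ge0.
split=> //; apply: le_lt_trans fin; rewrite le_eqVlt; apply/orP; left;
  apply/eqP.
by apply: eq_integral => x _ /=; rewrite ger0_norm ?sqr_ge0.
Qed.

Lemma sqnorm_Rintegral f : is_L2 L f ->
  sqnorm L f = (\int[mu]_(x in D) (cabs (f x) ^+ 2))%:E.
Proof.
by move=> /L2P[_ i]; rewrite /Rintegral fineK//; exact: integrable_fin_num i.
Qed.

Lemma L2norm_sqr f : L2norm L f ^+ 2 = \int[mu]_(x in D) (cabs (f x) ^+ 2).
Proof.
rewrite /L2norm sqr_sqrtr// fine_ge0// integral_ge0// => x _.
by rewrite lee_fin sqr_ge0.
Qed.

Lemma L2norm_ge0 f : 0 <= L2norm L f.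
Proof. exact: sqrtr_ge0. Qed.

Lemma L2_integrable_cabs f : is_L2 L f -> cintegrable L f.
Proof.
move=> /L2P[mf i]; apply/cintegrableP; split => //.
(* [|f| <= 1 + |f|^2], and the interval has finite measure. *)
apply: le_integrableR (integrableDR (integrable_cstR 1) i) _.
  exact: cmeasurable_cabs.
move=> x _; rewrite ger0_norm ?cabs_ge0//.
by have := sqr_ge0 (cabs (f x) - 1); set a := cabs _; clear; nra.
Qed.

Lemma L2_lin (a : C) f g : is_L2 L f -> is_L2 L g ->
  is_L2 L (fun x => a * f x + g x).
Proof.
move=> /L2P[mf fi] /L2P[mg gi]; apply/L2P.
have m : cmeasurable D (fun x => a * f x + g x).
  by apply: cmeasurableD => //; apply: cmeasurableM => //;
    exact: cmeasurable_cst.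
split=> //.
apply: le_integrableR (integrableDR (integrableZR (2 * cabs a ^+ 2) fi)
   (integrableZR 2 gi)) _.
  by apply: measurable_funX; exact: cmeasurable_cabs.
move=> x _; rewrite ger0_norm ?sqr_ge0// -mulrA -exprMn -cabsM -mulrDr.
have h := cabsD (a * f x) (g x).
apply: (@le_trans _ _ ((cabs (a * f x) + cabs (g x)) ^+ 2)).
  by rewrite lerXn2r ?nnegrE ?addr_ge0 ?cabs_ge0.
have := sqr_ge0 (cabs (a * f x) - cabs (g x)).
by set u := cabs _; set v := cabs _; clear; nra.
Qed.

Lemma L20 : is_L2 L (fun=> 0).
Proof.
apply/L2P; split; first exact: cmeasurable_cst.
exact: integrable_cstR.
Qed.

Lemma L2_bounded f K : cmeasurable D f -> (forall x, 0 < x < L ->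
  cabs (f x) <= K) ->
  is_L2 L f.
Proof.
move=> mf HK; apply/L2P; split=> //.
apply: le_integrableR (integrable_cstR (K ^+ 2)) _.
  by apply: measurable_funX; exact: cmeasurable_cabs.
move=> x xI; rewrite ger0_norm ?sqr_ge0//; have := HK _ xI => h.
by rewrite lerXn2r ?nnegrE ?cabs_ge0// (le_trans (cabs_ge0 _) h).
Qed.

Lemma L2_ae f g : cmeasurable D g -> is_L2 L f -> ae_eqf L f g -> 
  is_L2 L g /\ L2norm L f = L2norm L g.
Proof.
move=> mg Lf fg; have [mf fi] := (L2P f).1 Lf.
have e : ae_eq mu D (EFin \o (fun x => cabs (f x) ^+ 2)) (EFin \o (fun x
  => cabs (g x) ^+ 2)).
  have FF := ae_filter_ringOfSetsType mu.
  move: fg; rewrite /ae_eqf /ae_on; apply: filterS => x H xI /=.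
  by rewrite H.
have mf2 : measurable_fun D (EFin \o (fun x => cabs (f x) ^+ 2)).
  by apply/measurable_EFinP; apply: measurable_funX; exact: cmeasurable_cabs.
have mg2 : measurable_fun D (EFin \o (fun x => cabs (g x) ^+ 2)).
  by apply/measurable_EFinP; apply: measurable_funX; exact: cmeasurable_cabs.
have eI : sqnorm L f = sqnorm L g by exact: ae_eq_integral.
split; last by rewrite /L2norm eI.
have [mgr mgi] := mg; split=> //; rewrite -eI.
by have [] := Lf.
Qed.

Lemma L2norm_eq0 f : is_L2 L f -> L2norm L f <= 0 -> ae_eqf L f (fun=> 0).
Proof.
move=> Lf n0.
have {n0} : \int[mu]_(x in D) (cabs (f x) ^+ 2) = 0.
  rewrite -L2norm_sqr; have -> : L2norm L f = 0 by apply/eqP;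
    rewrite eq_le n0 L2norm_ge0.
  by rewrite expr0n.
have [mf fi] := (L2P f).1 Lf.
have mf2 : measurable_fun D (EFin \o (fun x => cabs (f x) ^+ 2)) by exact:
  (measurable_int mu fi).
have := sqnorm_Rintegral Lf => + e0; rewrite e0 /sqnorm => {}e0.
have Z : (\int[mu]_(x in D) `|(EFin \o (fun x => cabs (f x) ^+ 2)%R) x| = 0)%E.
  rewrite -[RHS]e0; apply: eq_integral => x _ /=.
  by rewrite ger0_norm ?sqr_ge0.
have H := (ae_eq_integral_abs mu (measurable_itv _) mf2).1 Z.
have FF := ae_filter_ringOfSetsType mu; move: H.
rewrite /ae_eqf /ae_on.
apply: filterS => x /= {}H xI; have [] := H xI.
by move=> /eqP; rewrite sqrf_eq0 => /eqP; exact: ComplexField.Normc.eq0_normc.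
Qed.

Lemma L2normZ (a : C) f : is_L2 L f ->
  L2norm L (fun x => a * f x) = cabs a * L2norm L f.
Proof.
move=> /L2P[mf fi]; apply/eqP; rewrite -(eqrXn2 (_ : 0 < 2)%N) ?mulr_ge0
  ?L2norm_ge0 ?cabs_ge0//.
rewrite exprMn !L2norm_sqr -RintegralZl//; apply/eqP/eq_Rintegral => x _.
by rewrite cabsM exprMn.
Qed.

End L2.

Section HilbertSchmidt.
Context {R : realType}.
Local Notation mu := (@lebesgue_measure R).
Local Notation C := R[i].
Local Notation RT := (measurableTypeR R).
Variable L : R.
Hypothesis L0 : 0 <= L.
Local Notation D := (`]0, L[%classic : set R).
Variables (k : R -> R -> C) (B : R).
Hypothesis mk : measurable_fun [set: RT * RT] (fun z : RT * RT => cabs (k z.1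
  z.2)).
Hypothesis k0 : forall x y, ~ (0 < y < L) -> k x y = 0.
Hypothesis kB : forall x y, 0 < x < L -> 0 < y < L -> cabs (k x y) <= B.

Let N x : \bar R := (\int[mu]_(y in D) (cabs (k x y) ^+ 2)%:E)%E.

Let mkx x : measurable_fun D (fun y => cabs (k x y)).
Proof.
apply: measurable_funTS.
exact: (measurableT_comp (f := fun z : RT * RT => cabs (k z.1 z.2)) mk
  (measurable_pair1 x)).
Qed.

Let mN : measurable_fun D N.
Proof.
apply: measurable_funTS.
have -> : N = (fun x => \int[mu]_y (cabs (k x y) ^+ 2)%:E)%E.
  apply/funext => x; rewrite /N integral_mkcond; apply: eq_integral => y _.
  rewrite patchE; case: ifPn => //; rewrite mem_setE in_itv/= => /negP yI.
  by rewrite k0// ComplexField.Normc.normc0 expr0n.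
pose F (z : RT * RT) : \bar R := (cabs (k z.1 z.2) ^+ 2)%:E.
have mF : measurable_fun setT F.
  by apply/measurable_EFinP; exact: measurable_funX.
have F0 z : (0 <= F z)%E by rewrite lee_fin sqr_ge0.
exact: (measurable_fun_fubini_tonelli_F (m2 := mu) F mF F0).
Qed.

Let NB x : 0 < x < L -> (N x <= (B ^+ 2 * L)%:E)%E.
Proof.
move=> xI; apply: (@le_trans _ _ (\int[mu]_(y in D) (B ^+ 2)%:E)%E).
  apply: ge0_le_integral => //.
  - by move=> y _; rewrite lee_fin sqr_ge0.
  - by apply/measurable_EFinP; apply: measurable_funX; exact: mkx.
  - move=> y /=; rewrite in_itv/= => yI;
    rewrite lee_fin lerXn2r ?nnegrE ?cabs_ge0 ?kB//.
    by apply: le_trans (kB xI yI); exact: cabs_ge0.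
by rewrite integral_cst//= measure_itv0L// EFinM.
Qed.

Let N0 x : (0 <= N x)%E.
Proof. by apply: integral_ge0 => y _; rewrite lee_fin sqr_ge0. Qed.

(** The Hilbert-Schmidt norm of the kernel [k]. *)
Definition hs_norm : R := Num.sqrt (fine
    (\int[mu]_(x in D) \int[mu]_(y in D) ((cabs (k x y)) ^+ 2)%:E)%E).

Let W_fin : (\int[mu]_(x in D) N x < +oo)%E.
Proof.
apply: (@le_lt_trans _ _ (\int[mu]_(y in D) (B ^+ 2 * L)%:E)%E).
  apply: ge0_le_integral; [exact: measurable_itv|by move=> x _;
    exact: N0|exact: mN|exact: measurable_cst|].
  by move=> x /=; rewrite in_itv/= => xI; exact: NB.
by rewrite integral_cst//= measure_itv0L// -EFinM ltry.
Qed.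

(** Cauchy-Schwarz in the second variable, followed by integration in the
    first.  The domination hypothesis on [u] avoids forming the integral operator
    itself. *)
Lemma hilbert_schmidt (c : R) (f u : R -> C) : 0 <= c -> is_L2 L f ->
  cmeasurable D u ->
  (forall x, 0 < x < L -> cabs (u x) <=
     c * \int[mu]_(y in D) (cabs (k x y) * cabs (f y))) ->
  is_L2 L u /\ L2norm L u <= c * hs_norm * L2norm L f.
Proof.
move=> c0 Lf mf_u Hu.
have [mf fi] := (L2P L f).1 Lf.
pose F := \int[mu]_(x in D) (cabs (f x) ^+ 2).
have F0 : 0 <= F by apply: Rintegral_ge0 => x _; exact: sqr_ge0.
have ux x : 0 < x < L -> ((cabs (u x) ^+ 2)%:E <= (c ^+ 2 * F)%:E * N x)%E.
  move=> xI.
  have ik : mu.-integrable D (EFin \o (fun y => cabs (k x y) ^+ 2)).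
    apply/integrableP; split.
      by apply/measurable_EFinP; apply: measurable_funX; exact: mkx.
    apply: le_lt_trans (ltry (B ^+ 2 * L)); apply: le_trans (NB xI).
    rewrite le_eqVlt; apply/orP; left; apply/eqP; apply: eq_integral => y _ /=.
    by rewrite ger0_norm ?sqr_ge0.
  have Nfin : N x \is a fin_num by exact: integrable_fin_num ik.
  rewrite -(fineK Nfin) -EFinM lee_fin -mulrA.
  apply: (@le_trans _ _ ((c * \int[mu]_(y in D) (cabs (k x y) * cabs (f y))) ^+
    2)).
    have h := Hu _ xI.
    by rewrite lerXn2r ?nnegrE ?cabs_ge0// (le_trans (cabs_ge0 _) h).
  rewrite exprMn ler_wpM2l ?sqr_ge0// mulrC.
  by apply: cauchy_schwarzR => //; exact: cmeasurable_cabs.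
have S : (sqnorm L u <= (c ^+ 2 * F)%:E * \int[mu]_(x in D) N x)%E.
  have <- : (\int[mu]_(x in D) ((c ^+ 2 * F)%:E * N x) =
      (c ^+ 2 * F)%:E * \int[mu]_(x in D) N x)%E.
    apply: ge0_integralZl; [exact: measurable_itv|exact: mN|by move=> x _;
      exact: N0|].
    by rewrite lee_fin mulr_ge0// sqr_ge0.
  apply: ge0_le_integral; first exact: measurable_itv.
  - by move=> x _; rewrite lee_fin sqr_ge0.
  - by apply/measurable_EFinP; apply: measurable_funX; exact: cmeasurable_cabs.
  - by apply: measurable_funeM; exact: mN.
  - by move=> x /=; rewrite in_itv/= => xI; exact: ux.
have Wfin : (\int[mu]_(x in D) N x)%E \is a fin_num.
  by rewrite ge0_fin_numE// integral_ge0.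
have Lu : is_L2 L u.
  have [mr mi] := mf_u; split=> //; apply: le_lt_trans S _.
  by rewrite -(fineK Wfin) -EFinM ltry.
split=> //.
rewrite -(ler_pXn2r (_ : 0 < 2)%N) ?nnegrE ?mulr_ge0 ?L2norm_ge0 ?sqrtr_ge0//.
rewrite !exprMn !L2norm_sqr -/F /hs_norm sqr_sqrtr; last first.
  by apply: fine_ge0; apply: integral_ge0 => x _; exact: N0.
rewrite -lee_fin -(sqnorm_Rintegral Lu); apply: le_trans S _.
by rewrite -[X in (_ * X <= _)%E](fineK Wfin) -EFinM lee_fin mulrAC.
Qed.
End HilbertSchmidt.

Section ACMeasurable.
Context {R : realType}.
Variable L : R.
Local Notation D := (`]0, L[%classic : set R).

Lemma real_AC_measurable (f : R -> R) : real_AC L f -> measurable_fun D f.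
Proof.
move=> Hf; apply: open_continuous_measurable_fun; first exact: interval_open.
move=> x; rewrite inE/= in_itv/= => /andP[x0 xL].
apply/cvgrPdist_lt => e e0; have [d d0 Hd] := real_AC_loc Hf e0.
apply/nbhs_ballP; exists (Num.min d (Num.min x (L - x))).
  by rewrite /= !lt_min d0 x0 subr_gt0.
move=> y; rewrite /ball/= !lt_min => /and3P[yd yx yL].
have xI : 0 <= x <= L by rewrite !ltW.
have yI : 0 <= y <= L.
  move: yx yL; rewrite !ltr_norml => /andP[_ h1] /andP[h2 _].
  by clear -h1 h2 x0 xL; apply/andP; split; lra.
by rewrite distrC; apply: Hd => //; rewrite distrC.
Qed.

Lemma abs_continuous_measurable (f : R -> R[i]) : abs_continuous L f ->
  cmeasurable D f.
Proof. by move=> /abs_continuousP[hr hi]; split; exact: real_AC_measurable. Qed.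

Lemma abs_continuous_L2 (f : R -> R[i]) : 0 <= L -> abs_continuous L f ->
  is_L2 L f.
Proof.
move=> L0 Hf; have [K HK] := abs_continuous_bounded L0 Hf.
apply: (@L2_bounded _ _ L0 f K); first exact: abs_continuous_measurable.
by move=> x /andP[x0 xL]; rewrite HK// !ltW.
Qed.
End ACMeasurable.

(** * Linear algebra of the boundary conditions *)

Section BoundaryAlgebra.
Context {R : realType}.
Local Notation C := R[i].
Variables (n : nat) (bc : @boundary_data R n).
Hypothesis hbc : boundary_ok bc.
Variable M : 'M[C]_n.

Lemma boundary_cond_lin a (u v u' v' : 'cV[C]_n) :
  boundary_cond bc u v -> boundary_cond bc u' v' ->
  boundary_cond bc (a *: u + u') (a *: v + v').
Proof.
case: bc => [k BL BR NL|] /=; last by move=> -> ->.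
move=> [h1 h2] [h3 h4]; rewrite !mulmxDr -!scalemxAr h1 h2 h3 h4.
by rewrite !scaler0 !addr0.
Qed.

Lemma boundary_cond0 : boundary_cond bc 0 0.
Proof. by case: bc => [k BL BR NL|] //=; rewrite !mulmx0. Qed.

Lemma evans_neq0_inj : evans_of bc M != 0 -> forall c,
  boundary_cond bc c (M *m c) -> c = 0.
Proof.
move: hbc; case: bc => [k BL BR NL|] /= H E c.
  case: H => _ _ _ [_ NLk] [BLc BRc].
  have : (c^T <= NL^T)%MS.
    by rewrite NLk; apply/sub_kermxP; rewrite -trmx_mul BLc trmx0.
  case/submxP => d cd.
  have {}cd : c = NL *m d^T by rewrite -[c]trmxK cd trmx_mul trmxK.
  have u : BR *m M *m NL \in unitmx by rewrite unitmxE unitfE.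
  have d0 : d^T = 0.
    have e : BR *m M *m NL *m d^T = 0 by rewrite -!mulmxA -cd.
    by rewrite -(mulKmx u d^T) e mulmx0.
  by rewrite cd d0 mulmx0.
move=> cM; have u : M - 1%:M \in unitmx by rewrite unitmxE unitfE.
by rewrite -(mulKmx u c) mulmxBl mul1mx -cM subrr mulmx0.
Qed.

Lemma det0_col m (B : 'M[C]_m) : \det B = 0 -> exists2 d : 'cV[C]_m,
  d != 0 & B *m d = 0.
Proof.
rewrite -det_tr => /eqP/det0P[v v0 vB]; exists v^T.
  by apply: contra v0 => /eqP v0; rewrite -[v]trmxK v0 trmx0.
by rewrite -[B]trmxK -trmx_mul vB trmx0.
Qed.

Lemma evans_eq0_sol : evans_of bc M = 0 -> exists2 c,
  c != 0 & boundary_cond bc c (M *m c).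
Proof.
move: hbc; case: bc => [k BL BR NL|] /= H /det0_col [d d0 dB].
  case: H => _ _ _ [NLf NLk]; exists (NL *m d).
    apply: contra d0 => /eqP NLd; apply/eqP.
    apply: trmx_inj; rewrite trmx0.
    by apply: (row_free_inj NLf); rewrite mul0mx -trmx_mul NLd trmx0.
  split; last by rewrite !mulmxA.
  have : (NL^T <= kermx BL^T)%MS by rewrite NLk.
  by move/sub_kermxP; rewrite -trmx_mul mulmxA => h;
    rewrite -[BL *m NL]trmxK h trmx0 mul0mx.
exists d => //; move: dB; rewrite mulmxBl mul1mx => /eqP.
by rewrite subr_eq0 => /eqP.
Qed.

(** The initial data [- E^-1 P v] correct the particular solution with
    value [0] at [0] and [M v] at [L], so that the boundary conditions hold.  Both
    cases follow from the product of a matrix and its adjugate. *)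
Lemma evans_projector (v : 'cV[C]_n) (E := evans_of bc M) (P := P_of bc M) :
  E != 0 ->
  boundary_cond bc (- (E^-1 *: (P *m v))) (M *m (v - E^-1 *: (P *m v))).
Proof.
move: hbc; rewrite /E /P; case: bc => [k BL BR NL|] /= H E0.
  case: H => _ _ _ [_ NLk].
  have BN : BL *m NL = 0.
    have : (NL^T <= kermx BL^T)%MS by rewrite NLk.
    by move/sub_kermxP; rewrite -trmx_mul => h;
      rewrite -[BL *m NL]trmxK h trmx0.
  split.
    by rewrite mulmxN -scalemxAr !mulmxA BN !mul0mx scaler0 oppr0.
  have := mul_mx_adj (BR *m M *m NL); set E' := \det _ in E0 *; move=> h.
  rewrite mulmxBr mulmxBr -!scalemxAr !mulmxA h.
  by rewrite -!mulmxA mul_scalar_mx scalerA mulVf// scale1r subrr.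
set E' := \det _ in E0 *.
have h : (M - 1%:M) *m (\adj (M - 1%:M) *m M) = E' *: M.
  by rewrite mulmxA mul_mx_adj mul_scalar_mx.
move: h; rewrite mulmxBl mul1mx => /eqP; rewrite subr_eq => /eqP h.
rewrite mulmxBr -scalemxAr mulmxA h mulmxDl -scalemxAl scalerDr scalerA mulVf//.
by rewrite scale1r opprD addrA subrr add0r.
Qed.
End BoundaryAlgebra.

(** * The boundary value problem and its Green operator *)

Section Operator.
Context {R : realType}.
Local Notation mu := (@lebesgue_measure R).
Local Notation C := R[i].
Local Notation Re := (@complex.Re R).
Local Notation Im := (@complex.Im R).
Variables (L : R) (n : nat) (eps : C) (A0 : R -> 'M[C]_n.+1)
  (bc : @boundary_data R n.+1) (U : C -> R -> 'M[C]_n.+1).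
Hypothesis hL : 0 < L.
Hypothesis hA0 : mxsmooth_on L A0.
Hypothesis hbc : boundary_ok bc.
Hypothesis hU : forall lam, is_fundamental L eps A0 lam (U lam).

Local Notation D := (`]0, L[%classic : set R).
Local Notation e1 := (delta_mx ord0 0 : 'cV[C]_n.+1).
Local Notation en := (delta_mx ord_max 0 : 'cV[C]_n.+1).
Let L0 : 0 <= L := ltW hL.

Lemma A0_bounded : mxbounded L A0.
Proof.
have [d [d0 dk]] := hA0.
have [K K0 HK] : mxbounded L (d 0%N).
  by apply: (mxderiv_bounded L0 (D := d 1%N)) => x xL; apply: dk;
    rewrite in_itv.
by exists K => // x xL i j; rewrite -d0 ?in_itv//; exact: HK.
Qed.

Lemma sysmx_bounded lam : mxbounded L (sysmx eps A0 lam).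
Proof.
have [K K0 HK] := A0_bounded.
pose B := (eps * lam) *: (en *m e1^T).
have [K' K'0 HK'] : mxbounded L (fun=> B) by apply: mxAC_bounded => //;
  exact: mxAC_cst.
exists (K + K'); first exact: addr_ge0.
move=> x xL i j; rewrite mxE; apply: le_trans (cabsD _ _) _.
by apply: lerD; [exact: HK|exact: (HK' x xL)].
Qed.

Lemma U_deriv lam x : 0 <= x <= L ->
  is_mxderiv_on L (U lam) x (sysmx eps A0 lam x *m U lam x).
Proof. by move=> xL; have [_ H] := hU lam; apply: H; rewrite in_itv. Qed.

Lemma U_at0 lam : U lam 0 = 1%:M. Proof. by have [] := hU lam. Qed.

Let U_AC lam := fund_AC L0 (sysmx_bounded lam) (@U_deriv lam).
Let V_AC lam := fund_inv_AC L0 (sysmx_bounded lam) (U_at0 lam) (@U_deriv lam).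
Let U_unit lam := fund_unit L0 (sysmx_bounded lam) (U_at0 lam) (@U_deriv lam).

(** The system for [Op y = f + lam y] is the system with matrix
    [sysmx eps A0 lam] for [(Op - lam) y = f]. *)
Lemma sysmxE lam x (u : 'cV[C]_n.+1) f :
  A0 x *m u + (eps * (f + lam * u ord0 0)) *: en =
  sysmx eps A0 lam x *m u + (eps * f) *: en.
Proof.
rewrite /sysmx mulmxDl -addrA; congr (_ + _).
rewrite -scalemxAl -mulmxA.
have -> : en *m (e1^T *m u) = u ord0 0 *: en.
  apply/matrixP => i j; rewrite trmx_delta -rowE !mxE big_ord1 !mxE (ord1 j).
  by rewrite mulrC.
by rewrite scalerA -scalerDl; congr (_ *: _); ring.
Qed.

(** The difference [w(x) - U(x) w(0)] solves the homogeneous system with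
    zero initial value, so it vanishes, and the boundary conditions force
    [w(0) = 0]. *)
Lemma bvp_unique lam (w : R -> 'cV[C]_n.+1) : evans L bc U lam != 0 ->
  mxabs_continuous L w ->
  ae_on L (fun x => is_mxderiv_on L w x (sysmx eps A0 lam x *m w x)) ->
  boundary_cond bc (w 0) (w L) -> forall x, 0 <= x <= L -> w x = 0.
Proof.
move=> E0 Hw Hae Hbc.
pose z x := w x + U lam x *m - w 0.
have z0 x : 0 <= x <= L -> z x = 0.
  apply: (gronwall_eq0 (A := sysmx eps A0 lam)) => //.
  - apply: mxACD => //; apply: mxACM => //; exact: mxAC_cst.
  - exact: sysmx_bounded.
  - apply: ae_onS Hae => y /andP[y0 yL] Hy; rewrite /z mulmxDr.
    apply: is_mxderivD => //; rewrite mulmxA; apply: is_mxderivMr.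
    by apply: U_deriv; rewrite !ltW.
  - by rewrite /z U_at0 mul1mx subrr.
have wE x : 0 <= x <= L -> w x = U lam x *m w 0.
  by move=> /z0; rewrite /z mulmxN => /eqP; rewrite subr_eq0 => /eqP.
have w0 : w 0 = 0.
  by apply: (evans_neq0_inj hbc E0); rewrite -wE// L0 lexx.
by move=> x xL; rewrite wE// w0 mulmx0.
Qed.

Lemma shift_lin lam a y f y' f' :
  op_shift_graph L eps A0 bc lam y f -> op_shift_graph L eps A0 bc lam y' f' ->
  op_shift_graph L eps A0 bc lam (fun x => a * y x + y' x) (fun x => a * f x +
    f' x).
Proof.
move=> [g [u [[Ly Lg] ACu uy odeu bu]] fg] [g' [u' [[Ly' Lg'] ACu' uy' odeu'
  bu']] fg'].
exists (fun x => a * g x + g' x); last first.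
  by apply: ae_on2 fg fg' => x _ -> ->; ring.
exists (fun x => a%:M *m u x + u' x); split.
- by split; exact: L2_lin.
- by apply: mxACD => //; apply: mxACM => //; exact: mxAC_cst.
- by apply: ae_on2 uy uy' => x _ <- <-; rewrite mxE mul_scalar_mx mxE.
- apply: ae_on2 odeu odeu' => x _ h h'.
  rewrite (_ : _ + _ = a%:M *m (A0 x *m u x + (eps * g x) *: en) +
    (A0 x *m u' x + (eps * g' x) *: en)); last first.
    rewrite !mul_scalar_mx mulmxDr -scalemxAr scalerDr addrACA; congr (_ + _).
    by rewrite scalerA -scalerDl; congr (_ *: _); ring.
  by apply: is_mxderivD => //; exact: is_mxderivMl.
- by rewrite !mul_scalar_mx; exact: boundary_cond_lin.
Qed.

Lemma shift_unique lam y y' f : evans L bc U lam != 0 ->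
  op_shift_graph L eps A0 bc lam y f -> op_shift_graph L eps A0 bc lam y' f ->
  ae_eqf L y y'.
Proof.
move=> E0 H H'; have [g [u [[Ly Lg] ACu uy odeu bu]] fg] := shift_lin (-1) H H'.
have u0 : forall x, 0 <= x <= L -> u x = 0.
  apply: (bvp_unique E0) => //.
  apply: ae_on2 odeu (ae_on2 (S := fun x => g x = lam * u x ord0 0) _ uy fg).
    by move=> x _ h gx; move: h; rewrite gx -[lam * _]add0r sysmxE mulr0
      scale0r addr0.
  move=> x _ -> /eqP; rewrite mulN1r addNr eq_sym subr_eq0 => /eqP->.
  by [].
apply: ae_onS uy => x /andP[x0 xL]; rewrite u0 ?ltW// mxE mulN1r => /esym/eqP.
by rewrite addrC subr_eq0 => /eqP ->.
Qed.

Lemma shift_ae lam y f f' : ae_eqf L f f' ->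
  op_shift_graph L eps A0 bc lam y f -> op_shift_graph L eps A0 bc lam y f'.
Proof.
move=> ff' [g Hg fg]; exists g => //.
by apply: ae_on2 ff' fg => x _ -> ->.
Qed.

Section Green.
Variable lam : C.
Hypothesis E0 : evans L bc U lam != 0.
Local Notation E := (evans L bc U lam).
Local Notation P := (P_of bc (U lam L)).
Local Notation V x := (invmx (U lam x)).

(** The vector [F(x)], the integral over [(0, x)] of [f U^-1 e_n]. *)
Definition green_F (f : R -> C) (x : R) : 'cV[C]_n.+1 :=
  \col_i Complex (primitive L (fun y => Re (V y i ord_max * f y)) x)
                 (primitive L (fun y => Im (V y i ord_max * f y)) x).

(** The solution given by variation of constants,
    [eps U(x) (F(x) - E^-1 P F(L))]. *)
Definition green_u (f : R -> C) (x : R) : 'cV[C]_n.+1 :=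
  eps%:M *m (U lam x *m (green_F f x - E^-1 *: (P *m green_F f L))).

(** The resolvent of the operator at [lam], when the Evans function does not
    vanish there. *)
Definition green_op (f : R -> C) (x : R) : C := green_u f x ord0 0.

Lemma green_integrand_integrable f i : is_L2 L f ->
  cintegrable L (fun y => V y i ord_max * f y).
Proof.
move=> Lf; apply: cintegrableMb.
- exact: abs_continuous_measurable (V_AC _ _ _).
- have [K HK] := abs_continuous_bounded L0 (V_AC lam i ord_max).
  by exists K => x /andP[x0 xL]; apply: HK; rewrite !ltW.
- exact: L2_integrable_cabs.
Qed.

Lemma green_F_AC f : is_L2 L f -> mxabs_continuous L (green_F f).
Proof.
move=> Lf i j; have [ir ii] := green_integrand_integrable i Lf;
  apply/abs_continuousP; split.
  rewrite (_ : (fun x => _) = primitive L (fun y => Re (V y i ord_max * f y))).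
    exact: primitive_AC ir.
  by apply/funext => x; rewrite mxE.
rewrite (_ : (fun x => _) = primitive L (fun y => Im (V y i ord_max * f y))).
  exact: primitive_AC ii.
by apply/funext => x; rewrite mxE.
Qed.

Lemma green_F_deriv f : is_L2 L f ->
  ae_on L (fun x => is_mxderiv_on L (green_F f) x (f x *: (V x *m en))).
Proof.
move=> Lf.
suff : ae_on L (fun x => forall i, is_cderiv_on L (fun y => green_F f y i 0) x
  (V x i ord_max * f x)).
  apply: ae_onS => x _ H i j; rewrite (ord1 j) -colE !mxE mulrC; exact: H.
apply: ae_on_forall => i; have [ir ii] := green_integrand_integrable i Lf.
apply: ae_on2 (primitive_deriv ir) (primitive_deriv ii) => x _ h1 h2; split.
  rewrite (_ : (fun x => _) = primitive L (fun y => Re (V y i ord_max * f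
    y)))//.
  by apply/funext => z; rewrite mxE.
rewrite (_ : (fun x => _) = primitive L (fun y => Im (V y i ord_max * f y)))//.
by apply/funext => z; rewrite mxE.
Qed.

Lemma green_F0 f : is_L2 L f -> green_F f 0 = 0.
Proof.
move=> Lf; apply/matrixP => i j; rewrite !mxE; have [ir ii] :=
  green_integrand_integrable i Lf.
by rewrite !primitive_start.
Qed.

Lemma green_u_AC f : is_L2 L f -> mxabs_continuous L (green_u f).
Proof.
move=> Lf; apply: mxACM => //; first exact: mxAC_cst.
apply: mxACM => //.
by apply: mxACD; [exact: green_F_AC|exact: mxAC_cst].
Qed.

Lemma green_u_deriv f : is_L2 L f -> ae_on L (fun x =>
  is_mxderiv_on L (green_u f) x (sysmx eps A0 lam x *m green_u f x + (eps * f
    x) *: en)).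
Proof.
move=> Lf; apply: ae_onS (green_F_deriv Lf) => x /andP[x0 xL] HF.
have xI : 0 <= x <= L by rewrite !ltW.
have HG := is_mxderivD HF (is_mxderiv_cst L (- (E^-1 *: (P *m green_F f L))) x).
have := is_mxderivMl eps%:M (is_mxderivM (U_deriv lam xI) HG).
congr (is_mxderiv_on _ _ _ _).
rewrite addr0 mulmxDr /green_u !mul_scalar_mx -!scalemxAr mulmxA;
  congr (_ + _); first by rewrite mulmxA.
by rewrite mulmxV ?U_unit// mul1mx scalerA.
Qed.

Lemma green_u_bc f : is_L2 L f -> boundary_cond bc (green_u f 0) (green_u f L).
Proof.
move=> Lf; rewrite /green_u green_F0// U_at0 mul1mx sub0r !mul_scalar_mx.
rewrite -[X in boundary_cond _ X _]addr0 -[X in boundary_cond _ _ X]addr0.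
apply: boundary_cond_lin; last exact: boundary_cond0.
exact: evans_projector.
Qed.

Lemma green_op_AC f : is_L2 L f -> abs_continuous L (green_op f).
Proof. by move=> /green_u_AC; exact. Qed.

Lemma green_op_graph f : is_L2 L f -> op_shift_graph L eps A0 bc lam (green_op
  f) f.
Proof.
move=> Lf; have LT : is_L2 L (green_op f) by apply: abs_continuous_L2 => //;
  exact: green_op_AC.
exists (fun x => lam * green_op f x + f x); last first.
  by apply: ae_onW => x _; ring.
exists (green_u f); split.
- by split=> //; exact: L2_lin.
- exact: green_u_AC.
- exact: ae_onW.
- apply: ae_onS (green_u_deriv Lf) => x _.
  by rewrite -sysmxE addrC [f x + _]addrC addrC.
- exact: green_u_bc.
Qed.

End Green.
End Operator.

(** * The Green kernel and the bound on the Green operator *)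

Section GreenKernel.
Context {R : realType}.
Local Notation mu := (@lebesgue_measure R).
Local Notation C := R[i].
Local Notation Re := (@complex.Re R).
Local Notation Im := (@complex.Im R).
Local Notation RT := (measurableTypeR R).
Variables (L : R) (n : nat) (eps : C) (A0 : R -> 'M[C]_n.+1)
  (bc : @boundary_data R n.+1) (U : C -> R -> 'M[C]_n.+1).
Hypothesis hL : 0 < L.
Hypothesis heps : cabs eps = 1.
Hypothesis hA0 : mxsmooth_on L A0.
Hypothesis hbc : boundary_ok bc.
Hypothesis hU : forall lam, is_fundamental L eps A0 lam (U lam).
Let L0 : 0 <= L := ltW hL.
Local Notation D := (`]0, L[%classic : set R).

Variable lam : C.
Local Notation E := (evans L bc U lam).
Local Notation P := (P_of bc (U lam L)).

(** Extension by zero outside [(0, L)], which makes the entries measurable on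
    the whole line and hence the kernel jointly measurable. *)
Definition cut_mx (F : R -> 'M[C]_n.+1) (x : R) : 'M[C]_n.+1 :=
  if (0 < x) && (x < L) then F x else 0.

(** The Green kernel [G(x, y, lam)], extended by zero outside the square. *)
Definition green_kernel (x y : R) : C :=
  ((if y < x then cut_mx (U lam) x *m (E%:M - P) else - (cut_mx (U lam) x *m
    P)) *m
   cut_mx (fun z => invmx (U lam z)) y) ord0 ord_max.

Lemma green_kernelE x y : 0 < x < L -> 0 < y < L ->
  green_kernel x y = green L bc U x y lam.
Proof.
move=> xI yI; rewrite /green_kernel /cut_mx xI yI /green /green_mx.
by case: ifP => // _; rewrite mulNmx.
Qed.

Lemma green_kernel0 x y : ~ (0 < y < L) -> green_kernel x y = 0.
Proof. by move=> /negP/negbTE yI; rewrite /green_kernel /cut_mx yI mulmx0 mxE.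
  Qed.

Lemma cut_mx_bounded (F : R -> 'M[C]_n.+1) : mxbounded L F ->
  exists2 K, 0 <= K & forall x i j, cabs (cut_mx F x i j) <= K.
Proof.
move=> [K K0 HK]; exists K => // x i j; rewrite /cut_mx;
  case: ifP => [/andP[x0 xL]|_].
  by apply: HK; rewrite !ltW.
by rewrite mxE ComplexField.Normc.normc0.
Qed.

Lemma cut_mx_measurable (F : R -> 'M[C]_n.+1) i j : mxabs_continuous L F ->
  cmeasurable [set: R] (fun x => cut_mx F x i j).
Proof.
move=> /(_ i j)/abs_continuous_measurable[mr mi]; split.
  have -> : (fun x => Re (cut_mx F x i j)) = (fun x => Re (F x i j)) \_ D.
    apply/funext => x; rewrite patchE mem_setE in_itv/= /cut_mx;
      case: ifP => //.
    by rewrite mxE.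
  exact/(measurable_restrictT _ _).1.
have -> : (fun x => Im (cut_mx F x i j)) = (fun x => Im (F x i j)) \_ D.
  apply/funext => x; rewrite patchE mem_setE in_itv/= /cut_mx; case: ifP => //.
  by rewrite mxE.
exact/(measurable_restrictT _ _).1.
Qed.

Let U_AC := fund_AC L0 (sysmx_bounded eps hL hA0 lam) (@U_deriv _ _ _ _ _ _ hU
  lam).
Let V_AC := fund_inv_AC L0 (sysmx_bounded eps hL hA0 lam) (U_at0 hU lam)
  (@U_deriv _ _ _ _ _ _ hU lam).

Lemma cmeasurable_comp d (T : measurableType d) (h : R -> C) (p : T -> R) :
  cmeasurable [set: R] h -> measurable_fun [set: T] p ->
  cmeasurable [set: T] (fun z => h (p z)).
Proof.
move=> [mr mi] mp; split.
  exact: (measurableT_comp (f := fun x => Re (h x)) mr mp).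
exact: (measurableT_comp (f := fun x => Im (h x)) mi mp).
Qed.

Lemma cut_mx_mul_measurable (Q : 'M[C]_n.+1) : cmeasurable [set: RT * RT] (fun
  z : RT * RT =>
  (cut_mx (U lam) z.1 *m Q *m cut_mx (fun z => invmx (U lam z)) z.2) ord0
    ord_max).
Proof.
have -> : (fun z : RT * RT =>
  (cut_mx (U lam) z.1 *m Q *m cut_mx (fun z => invmx (U lam z)) z.2) ord0
    ord_max) =
  (fun z : RT * RT => \sum_k (\sum_l cut_mx (U lam) z.1 ord0 l * Q l k) *
      cut_mx (fun z => invmx (U lam z)) z.2 k ord_max).
  by apply/funext => z; rewrite mxE; apply: eq_bigr => k _; rewrite mxE.
apply: cmeasurable_sum => k; apply: cmeasurableM.
  apply: cmeasurable_sum => l; apply: cmeasurableM; last exact: cmeasurable_cst.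
  by apply: (cmeasurable_comp (cut_mx_measurable ord0 l U_AC));
    exact: measurable_fst.
by apply: (cmeasurable_comp (cut_mx_measurable k ord_max V_AC));
  exact: measurable_snd.
Qed.

Lemma green_kernel_measurable :
  measurable_fun [set: RT * RT] (fun z : RT * RT => cabs (green_kernel z.1
    z.2)).
Proof.
have -> : (fun z : RT * RT => cabs (green_kernel z.1 z.2)) = (fun z : RT * RT =>
  if z.2 < z.1 then
   cabs ((cut_mx (U lam) z.1 *m (E%:M - P) *m cut_mx (fun z => invmx (U lam z))
     z.2) ord0 ord_max)
  else
   cabs ((cut_mx (U lam) z.1 *m (- P) *m cut_mx (fun z => invmx (U lam z)) z.2)
     ord0 ord_max)).
  by apply/funext => z; rewrite /green_kernel; case: ifP => // _;
    rewrite mulmxN.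
apply: measurable_fun_ifT.
- by apply: measurable_fun_ltr; [exact: measurable_snd|exact: measurable_fst].
- exact: cmeasurable_cabs (cut_mx_mul_measurable _).
- exact: cmeasurable_cabs (cut_mx_mul_measurable _).
Qed.

Lemma green_kernel_bounded : exists B, forall x y, cabs (green_kernel x y) <= B.
Proof.
have [K1 K10 H1] := cut_mx_bounded (mxAC_bounded L0 U_AC).
have [K2 K20 H2] := cut_mx_bounded (mxAC_bounded L0 V_AC).
have H (Q : 'M[C]_n.+1) : exists2 B, 0 <= B & forall x y,
    cabs ((cut_mx (U lam) x *m Q *m cut_mx (fun z => invmx (U lam z)) y) ord0
      ord_max) <= B.
  exists (\sum_(k < n.+1) (\sum_(l < n.+1) K1 * cabs (Q l k)) * K2).
    by apply: sumr_ge0 => k _; rewrite mulr_ge0// sumr_ge0// => l _;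
      rewrite mulr_ge0// cabs_ge0.
  move=> x y; rewrite mxE; apply: le_trans (cabs_sum _ _ _) _.
  apply: ler_sum => k _; rewrite cabsM; apply: ler_pM; rewrite ?cabs_ge0//.
  rewrite mxE; apply: le_trans (cabs_sum _ _ _) _; apply: ler_sum => l _.
  by rewrite cabsM ler_wpM2r ?cabs_ge0.
have [B1 B10 HB1] := H (E%:M - P); have [B2 B20 HB2] := H (- P).
exists (B1 + B2) => x y; rewrite /green_kernel; case: ifP => _.
  by apply: le_trans (HB1 x y) _; rewrite lerDl.
by rewrite -mulmxN; apply: le_trans (HB2 x y) _; rewrite lerDr.
Qed.

Lemma weightE : weight L bc U lam = hs_norm L green_kernel.
Proof.
rewrite /weight /hs_norm; congr (Num.sqrt (fine _)).
apply: eq_integral => x; rewrite mem_setE in_itv/= => xI.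
apply: eq_integral => y; rewrite mem_setE in_itv/= => yI.
by rewrite green_kernelE.
Qed.

(** The function [y |-> G(x, y) f(y)] expanded into scalar terms, separating
    the factors that depend on [x] from the integrands of [F(x)] and [F(L)]. *)
Definition green_kernel_sum (f : R -> C) (x y : R) : C :=
  \sum_k (E * U lam x ord0 k *
        ((if y < x then 1 else 0) * (invmx (U lam y) k ord_max * f y)) +
      (- (U lam x *m P) ord0 k) * (invmx (U lam y) k ord_max * f y)).

Lemma green_kernel_mul f x y : 0 < x < L -> 0 < y < L ->
  green_kernel x y * f y = green_kernel_sum f x y.
Proof.
move=> xI yI; rewrite /green_kernel /cut_mx xI yI mxE mulr_suml;
  apply: eq_bigr => k _.
case: ifP => _.
  rewrite mulmxBr mul_mx_scalar [in LHS]mxE [in X in (X + _) * _ * _]mxE.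
  by rewrite [in X in (_ + X) * _ * _]mxE mul1r mulrDl mulrDl !mulrA.
by rewrite mul0r mulr0 add0r [in LHS]mxE mulrA.
Qed.

Lemma cint_upto g x : cintegrable L g ->
  cint L (fun y => (if y < x then 1 else 0) * g y) =
  Complex (primitive L (fun y => Re (g y)) x) (primitive L (fun y => Im (g y))
    x).
Proof.
move=> [gr gi]; rewrite /cint !primitiveE//.
congr Complex; apply: eq_Rintegral => y _; rewrite ?ReM ?ImM; case: ifP => _ /=;
  by rewrite ?mul1r ?mul0r ?subr0 ?addr0.
Qed.

Lemma cint_primitive g : cintegrable L g ->
  cint L g = Complex (primitive L (fun y => Re (g y)) L) (primitive L (fun y
    => Im (g y)) L).
Proof. by move=> [gr gi]; rewrite /cint !primitive_end. Qed.

Lemma cintegrable_upto g x : cintegrable L g ->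
  cintegrable L (fun y => (if y < x then 1 else 0) * g y).
Proof.
move=> ig; apply: cintegrableMb => //.
  split.
    rewrite (_ : (fun y => _) = fun y => if y < x then 1 else 0); last first.
      by apply/funext => y; case: ifP.
    apply: measurable_funTS; apply: measurable_fun_ifT => //.
    exact: measurable_fun_ltr.
  by rewrite (_ : (fun y => _) = fun=> 0)//; apply/funext => y; case: ifP.
exists 1 => y _; case: ifP => _.
  by rewrite ComplexField.Normc.normc1.
by rewrite ComplexField.Normc.normc0.
Qed.

Lemma green_kernel_sum_integrable f x : is_L2 L f ->
  cintegrable L (green_kernel_sum f x).
Proof.
move=> Lf.
apply: (@cintegrable_sum _ _ _ _ (fun k y => E * U lam x ord0 k *
        ((if y < x then 1 else 0) * (invmx (U lam y) k ord_max * f y)) +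
      (- (U lam x *m P) ord0 k) * (invmx (U lam y) k ord_max * f y))) => k.
have ig := green_integrand_integrable hL hA0 hU lam k Lf.
by apply: cintegrableD; apply: cintegrableZ => //; exact: cintegrable_upto.
Qed.

(** On [(0, L)], the resolvent is [eps / E] times the integral operator of
    the Green kernel. *)
Lemma green_opE f x : E != 0 -> is_L2 L f -> 0 < x < L ->
  green_op L eps bc U lam f x = eps * E^-1 * cint L (green_kernel_sum f x).
Proof.
move=> E0 Lf xI.
pose g k y := invmx (U lam y) k ord_max * f y.
have ig k : cintegrable L (g k) by exact: (green_integrand_integrable hL hA0
  hU).
pose G k y := E * U lam x ord0 k * ((if y < x then 1 else 0) * g k y) +
    (- (U lam x *m P) ord0 k) * g k y.
rewrite (_ : cint L _ = \sum_k cint L (G k)); last first.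
  apply: (@cint_sum _ _ _ _ G).
  by move=> k; apply: cintegrableD; apply: cintegrableZ => //;
    exact: cintegrable_upto.
pose F := green_F L U lam f.
rewrite (eq_bigr (fun k => E * U lam x ord0 k * F x k 0 - (U lam x *m P) ord0 k
  * F L k 0)); last first.
  move=> k _; rewrite /G cintD; [|by apply: cintegrableZ;
    exact: cintegrable_upto|exact: cintegrableZ].
  rewrite !cintZ//; last exact: cintegrable_upto.
  by rewrite cint_upto// cint_primitive// /F [green_F _ _ _ _ _ _ _]mxE
    [green_F _ _ _ _ _ _ _]mxE mulNr.
rewrite sumrB -mulrA mulrBr.
rewrite (_ : \sum_k (U lam x *m P) ord0 k * F L k 0 = (U lam x *m P *m F L)
  ord0 0); last by rewrite [RHS]mxE.
under eq_bigr do rewrite -mulrA.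
rewrite -mulr_sumr mulKf//.
rewrite (_ : \sum_k U lam x ord0 k * F x k 0 = (U lam x *m F x) ord0 0);
  last by rewrite [RHS]mxE.
rewrite /green_op /green_u mul_scalar_mx [LHS]mxE -/F mulmxBr -scalemxAr mulmxA.
by congr (_ * _); rewrite [LHS]mxE; congr (_ + _); rewrite [LHS]mxE [in LHS]mxE.
Qed.

Lemma green_op_bound f : E != 0 -> is_L2 L f ->
  L2norm L (green_op L eps bc U lam f) <= weight L bc U lam / cabs E * L2norm L
    f.
Proof.
move=> E0 Lf; have [B HB] := green_kernel_bounded.
have mT := abs_continuous_measurable (green_op_AC bc hL hA0 hU lam Lf).
have c0 : 0 <= (cabs E)^-1 by rewrite invr_ge0 cabs_ge0.
suff bnd : forall x, 0 < x < L -> cabs (green_op L eps bc U lam f x) <=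
    (cabs E)^-1 * \int[mu]_(y in D) (cabs (green_kernel x y) * cabs (f y)).
  have [_] := hilbert_schmidt L0 green_kernel_measurable green_kernel0 (fun x y
    _ _ => HB x y) c0 Lf mT bnd.
  by rewrite -weightE (mulrC _^-1).
move=> x xI; rewrite green_opE// !cabsM heps mul1r ComplexField.Normc.normcV.
rewrite ler_wpM2l//.
apply: le_trans (cabs_cint (green_kernel_sum_integrable x Lf)) _.
rewrite le_eqVlt; apply/orP; left; apply/eqP; apply: eq_Rintegral => y.
by rewrite mem_setE in_itv/= => yI; rewrite -green_kernel_mul// cabsM.
Qed.
End GreenKernel.

(** * Resolvent set and Evans function *)

Section Spectrum.
Context {R : realType}.
Local Notation C := R[i].
Variables (L : R) (n : nat) (eps : C) (A0 : R -> 'M[C]_n.+1)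
  (bc : @boundary_data R n.+1) (U : C -> R -> 'M[C]_n.+1).
Hypothesis hL : 0 < L.
Hypothesis heps : cabs eps = 1.
Hypothesis hA0 : mxsmooth_on L A0.
Hypothesis hbc : boundary_ok bc.
Hypothesis hwd : op_well_defined L eps A0 bc.
Hypothesis hU : forall lam, is_fundamental L eps A0 lam (U lam).
Let L0 : 0 <= L := ltW hL.

Lemma evans_resolvent lam : evans L bc U lam != 0 ->
  is_resolvent L eps A0 bc lam (green_op L eps bc U lam).
Proof.
move=> E0; have G f := green_op_graph hL hA0 hbc hU E0 (f := f).
split.
- split.
  + by move=> f Lf; apply: abs_continuous_L2 => //;
    exact: (green_op_AC bc hL hA0 hU).
  + move=> f g Lf Lg fg; apply: (shift_unique hL hA0 hbc hU E0 (G f Lf)).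
    by apply: shift_ae (G g Lg); apply: ae_onS fg => x _ ->.
  + move=> a f g Lf Lg; have H1 := G _ (L2_lin a Lf Lg).
    have H2 := shift_lin hL a (G f Lf) (G g Lg).
    exact: (shift_unique hL hA0 hbc hU E0 H1 H2).
  + exists (weight L bc U lam / cabs (evans L bc U lam)) => f Lf.
    exact: (green_op_bound hL heps hA0 hU).
- exact: G.
- by move=> y f Lf H; apply: (shift_unique hL hA0 hbc hU E0 (G f Lf)).
Qed.

(** A zero of the Evans function is an eigenvalue.  Uniqueness of the witness
    is what keeps the eigenfunction from vanishing almost everywhere. *)
Lemma evans_eigen lam : evans L bc U lam = 0 ->
  exists y, [/\ is_L2 L y, ~ ae_eqf L y (fun=> 0) &
    op_graph L eps A0 bc y (fun x => lam * y x)].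
Proof.
move=> /(evans_eq0_sol hbc)[c c0 bcc].
pose u x := U lam x *m c; pose y x := u x ord0 0.
have bA := sysmx_bounded eps hL hA0 lam.
have UD := @U_deriv _ _ _ _ _ _ hU lam.
have ACu : mxabs_continuous L u by exact: (fund_solAC L0 bA UD).
have Ly : is_L2 L y by apply: abs_continuous_L2 => //; exact: ACu.
have Lly : is_L2 L (fun x => lam * y x).
  have -> : (fun x => lam * y x) = (fun x => lam * y x + 0) by apply/funext
    => x; rewrite addr0.
  by apply: L2_lin => //; exact: L20.
have ode x : 0 < x < L -> is_mxderiv_on L u x
    (A0 x *m u x + (eps * (lam * y x)) *: delta_mx ord_max 0).
  move=> /andP[x0 xL].
  rewrite -[lam * _]add0r sysmxE mulr0 scale0r addr0.
  by apply: (fund_deriv UD); rewrite !ltW.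
have bu : boundary_cond bc (u 0) (u L) by rewrite /u (U_at0 hU) mul1mx.
have W : op_witness L eps A0 bc y (fun x => lam * y x) u.
  by split=> //; exact: ae_onW.
exists y; split=> //; last by exists u.
move=> y0; have W0 : op_witness L eps A0 bc y (fun=> 0) (fun=> 0).
  split.
  - by split=> //; exact: L20.
  - exact: mxAC_cst.
  - by apply: ae_onS y0 => x _ ->; rewrite mxE.
  - apply: ae_onW => x _; rewrite mulmx0 mulr0 scale0r addr0.
    exact: is_mxderiv_cst.
  - exact: boundary_cond0.
(* By uniqueness of the witness [u 0 = 0], while [u 0 = c]. *)
have := hwd W W0 (x := 0); rewrite in_itv/= lexx L0 => /(_ isT).
by rewrite /u (U_at0 hU) mul1mx => /eqP; rewrite (negbTE c0).
Qed.

(** A resolvent at a zero of the Evans function would send [0] both to [0]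
    and to an eigenfunction. *)
Lemma evans_neq0 lam : resolvent_set L eps A0 bc lam -> evans L bc U lam != 0.
Proof.
move=> [T [_ _ Tu]]; apply/eqP => /evans_eigen[y [Ly y0 Hy]]; apply: y0.
have H0 : op_shift_graph L eps A0 bc lam y (fun=> 0).
  by exists (fun x => lam * y x) => //; apply: ae_onW => x _; rewrite subrr.
have H00 : op_shift_graph L eps A0 bc lam (fun=> 0) (fun=> 0).
  exists (fun=> 0); last by apply: ae_onW => x _; rewrite mulr0 subr0.
  exists (fun=> 0); split.
  - by split; exact: L20.
  - exact: mxAC_cst.
  - by apply: ae_onW => x _; rewrite mxE.
  - apply: ae_onW => x _; rewrite mulmx0 mulr0 scale0r addr0.
    exact: is_mxderiv_cst.
  - exact: boundary_cond0.
apply: ae_on2 (Tu _ _ (L20 L0) H0) (Tu _ _ (L20 L0) H00) => x _ -> ->.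
by [].
Qed.

Lemma resolvent_evansP lam : resolvent_set L eps A0 bc lam <->
  evans L bc U lam != 0.
Proof.
split; first exact: evans_neq0.
by move=> /evans_resolvent H; eexists; exact: H.
Qed.

(** An eigenfunction [y] for [lam] is the image of [(lam - lams) y] under the
    resolvent at [lams], whose norm is at most [W / |E|].  When the weight is
    [0], the quotient is [0] and the disk is empty. *)
Lemma resolvent_disk lams lam : resolvent_set L eps A0 bc lams ->
  cabs (lam - lams) < cabs (evans L bc U lams) / weight L bc U lams ->
  resolvent_set L eps A0 bc lam.
Proof.
move=> /resolvent_evansP Es ld; apply/resolvent_evansP/eqP => /evans_eigen[y
  [Ly y0 Hy]].
apply: y0; apply: L2norm_eq0 => //.
have H : op_shift_graph L eps A0 bc lams y (fun x => (lam - lams) * y x).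
  by exists (fun x => lam * y x) => //; apply: ae_onW => x _; rewrite mulrBl.
have Lf : is_L2 L (fun x => (lam - lams) * y x).
  rewrite (_ : (fun x => _) = fun x => (lam - lams) * y x + 0).
    by apply: L2_lin => //; exact: L20.
  by apply/funext => x; rewrite addr0.
have [_ _ Tu] := evans_resolvent Es.
have e := Tu _ _ Lf H.
have my := ((L2P L y).1 Ly).1.
have LT : is_L2 L (green_op L eps bc U lams (fun x => (lam - lams) * y x)).
  by apply: abs_continuous_L2 => //; exact: (green_op_AC bc hL hA0 hU).
have [_ ne] := L2_ae my LT e.
have := green_op_bound hL heps hA0 hU Es Lf.
rewrite ne L2normZ// mulrA => b.
have Ep : 0 < cabs (evans L bc U lams).
  rewrite lt_neqAle cabs_ge0 andbT eq_sym; apply: contra Es => /eqP.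
  by move=> /ComplexField.Normc.eq0_normc ->.
have W0 : 0 < weight L bc U lams.
  rewrite lt_neqAle sqrtr_ge0 andbT eq_sym; apply: contraTneq ld => ->.
  by rewrite invr0 mulr0 -leNgt cabs_ge0.
set q := _ * cabs (lam - lams) in b.
have q1 : q < 1.
  by rewrite /q mulrAC ltr_pdivrMr// mul1r mulrC -ltr_pdivlMr.
(* [|y| <= q |y|] with [q < 1] excludes [|y| > 0]. *)
rewrite leNgt; apply/negP => yp; move: b; rewrite leNgt.
by rewrite -[X in _ < X]mul1r ltr_pM2r// q1.
Qed.

End Spectrum.

Theorem mainTheorem1 (R : realType) (L : R) (n : nat) (eps : R[i])
    (A0 : R -> 'M[R[i]]_n.+1) (bc : @boundary_data R n.+1)
    (U : R[i] -> R -> 'M[R[i]]_n.+1)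
    (hL : 0 < L) (heps : eps = 1 \/ eps = -1)
    (hA0 : mxsmooth_on L A0)
    (hbc : boundary_ok bc)
    (hwd : op_well_defined L eps A0 bc)
    (hcompact : has_compact_resolvent L eps A0 bc)
    (hU : forall lam, is_fundamental L eps A0 lam (U lam)) :
  [/\ forall lam, spectrum L eps A0 bc lam <-> evans L bc U lam = 0,
      forall lams, resolvent_set L eps A0 bc lams ->
        [set lam | cabs (lam - lams)
                   < cabs (evans L bc U lams) / weight L bc U lams]
          `<=` resolvent_set L eps A0 bc &
      forall lams, resolvent_set L eps A0 bc lams ->
        ((cabs (evans L bc U lams) / weight L bc U lams)%:E
           <= cdist lams (spectrum L eps A0 bc))%E].
Proof.
have heps1 : cabs eps = 1.
  by case: heps => ->; rewrite ?cabsN ComplexField.Normc.normc1.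
have resP := resolvent_evansP hL heps1 hA0 hbc hwd hU.
have dsk := resolvent_disk hL heps1 hA0 hbc hwd hU.
split.
- move=> lam; split=> [nres|E0].
    by apply/eqP; apply: contrapT => /negP E0; apply: nres; apply/resP.
  by move=> /resP; rewrite E0 eqxx.
- by move=> lams Hs lam; exact: dsk.
- move=> lams Hs; apply: le_ereal_inf_tmp => _ [w wS <-]; rewrite lee_fin leNgt.
  by apply/negP => /(dsk _ _ Hs).
Qed.
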